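(* Let $S$ be a set with $|S|\ge 2$, let $(\mathcal{F}_j)_{j\ge 0}$ be families of finite subsets of $\overline{S}=S^{\mathbb{N}}$ as described in the context, let $Y$ be a reflexive Banach space with a seminormalized unconditional basis $(e_j)_{j=0}^\infty$ whose norm $\|\cdot\|_Y$ is $1$-unconditional (with respect to $(e_j)$) and $2R$, and let $X$, with norms $\|\cdot\|$ and $\|\cdot\|_*$, be the associated space described in the context. The following are equivalent: (1) $(X,\|\cdot\|)$ is reflexive. (2) $(X,\|\cdot\|_* )$ has the $2R$ property.
   Context: A norm $\|\cdot\|$ on a Banach space $X$ is $2$-rotund ($2R$) if for every sequence $(x_n)\subset X$ with $\|x_n\|\le 1$ for all $n$ and $\lim_{m,n\to\infty}\|x_m+x_n\|=2$, there exists $x\in X$ with $x_n\to x$ in norm. A basis $(e_j)$ is $1$-unconditional for a norm if $\|\sum \pm a_je_j\|\le\|\sum a_je_j\|$ for all scalars and all choices of signs. Seminormalized means $0<\inf_j\|e_j\|\le\sup_j\|e_j\|<\infty$. Families of sets. Let $\overline{S}=S^{\mathbb{N}}$. For distinct $p=(p(i))_{i\ge1}$, $q=(q(i))_{i\ge1}$ in $\overline{S}$ let $d(p,q)=\min\{k\ge 1: p(k)\ne q(k)\}$. For $A\subset\overline{S}$ with $|A|\ge2$ let $A^\sharp=\min\{d(p,q):p,q\in A,\ p\ne q\}$. Let $\mathcal{F}_0=\{\emptyset\}\cup\{\{p\}:p\in\overline{S}\}$. For $j\ge1$, $\mathcal{F}_j$ is any hereditary family (closed under taking subsets) of finite subsets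 of $\overline{S}$ such that $\mathcal{F}_{j-1}\subseteq\mathcal{F}_j$ and every $A\in\mathcal{F}_j$ with $|A|\ge2$ can be written $A=\bigcup_{i=1}^{A^\sharp}A_i$ with $A_i\in\mathcal{F}_{j-1}$ for $1\le i\le A^\sharp$. Norms. $c_{00}(\overline{S})$ is the space of finitely supported scalar functions $x=(x_\gamma)_{\gamma\in\overline{S}}$. For finite $F\subseteq\overline{S}$ let $\Theta_F(x)=\sum_{\gamma\in F}|x_\gamma|$. For $j\ge0$ let $\|x\|_j=\sup_{F\in\mathcal{F}_j}\Theta_F(x)$. In particular $\|x\|_0=\sup_\gamma|x_\gamma|$. For a family of scalars $a$ (a finite sequence, or an element of $c_0$ of some index set), the Day norm is $\|a\|_{\mathrm{Day}}=(\sum_{n=1}^\infty4^{-n}a_n^{*2})^{1/2}$, where $(a_n^* )$ is the non-increasing rearrangement of the absolute values of the entries (padded with zeros). Let $|\!|\!|x|\!|\!|_j=\sup\|(\Theta_{F_i}(x))_{i=1}^N\|_{\mathrm{Day}}$, the supremum being over all $N\in\mathbb{N}$ and all disjoint $F_1,\dots,F_N\in\mathcal{F}_j$. The space $X$. $X$ is the completion of $c_{00}(\overline{S})$ under $\|x\|=\big\|\sum_{j=0}^\infty 2^{-j}\|x\|_je_j\big\|_Y$. The (semi)norms $\Theta_F$ (for finite $F\subseteq\overline{S}$), $\|\cdot\|_j$ and $|\!|\!|\cdot|\!|\!|_j$ (for $j\ge0$), and $x\mapsto\|(x_\gamma)_{\gamma\in\overline{S}}\|_{\mathrm{Day}}$,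 defined on $c_{00}(\overline{S})$, extend continuously to $X$. The second norm is $$\|x\|_*=\Big(\|x\|^2+\|x\|_{\mathrm{Day}}^2+\sum_{j=0}^\infty\varepsilon_j|\!|\!|x|\!|\!|_j^2\Big)^{1/2},$$ where $\|x\|_{\mathrm{Day}}$ is the Day norm of $(x_\gamma)_{\gamma\in\overline{S}}$ and $(\varepsilon_j)$ is a fixed sequence of positive reals tending to $0$ fast enough that the series converges for all $x\in X$ and $\|\cdot\|_*$ is equivalent to $\|\cdot\|$. *)

(* Defs.v *)
From HB Require Import structures.
From mathcomp Require Import all_boot all_order all_algebra finmap.
From mathcomp Require Import all_classical all_reals all_analysis.

Set Implicit Arguments.
Unset Strict Implicit.
Unset Printing Implicit Defensive.

Import Order.TTheory GRing.Theory Num.Theory.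
Import numFieldNormedType.Exports.

Local Open Scope classical_set_scope.
Local Open Scope ring_scope.

Section Dual.
Variables (R : realType) (X : normedModType R).

Definition is_dual : {pred X -> R^o} :=
  fun f => `[< linear f /\ continuous f >].

Fact is_dual_submod_closed : submod_closed is_dual.
Proof.
split=> [|a f g /asboolP[lf cf] /asboolP[lg cg]]; apply/asboolP; split.
- by move=> b u v; rewrite -![(0 : X -> R^o) _]/(0 : R^o) scaler0 addr0.
- exact: cst_continuous.
- move=> b u v; rewrite -![(a *: f + g) _]/(a *: f _ + g _) lf lg.
  by rewrite !scalerDr !scalerA (mulrC a b) addrACA.
- move=> x; apply: cvgD; last exact: cg.
  by apply: cvgZl_tmp; exact: cf.
Qed.

HB.instance Definition _ :=
  GRing.isSubmodClosed.Build R (X -> R^o) is_dual is_dual_submod_closed.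

Record cdual := CDual { dual_fun :> X -> R^o ; _ : dual_fun \in is_dual }.

HB.instance Definition _ := [isSub for dual_fun].
HB.instance Definition _ := [Choice of cdual by <:].
HB.instance Definition _ := [SubChoice_isSubLmodule of cdual by <:].

Fact cdual_linear (f : cdual) : linear (f : X -> R^o).
Proof. by case: f => f /= /asboolP[]. Qed.

Fact cdual_continuous (f : cdual) : continuous (f : X -> R^o).
Proof. by case: f => f /= /asboolP[]. Qed.

HB.instance Definition _ (f : cdual) :=
  GRing.isLinear.Build R X R^o _ (f : X -> R^o) (@cdual_linear f).

Definition dual_norm (f : cdual) : R :=
  sup [set `|f x| | x in [set x : X | `|x| <= 1]].

Let dual_has_ubound (f : cdual) :
  has_ubound [set `|f x| | x in [set x : X | `|x| <= 1]].
Proof.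
have /linear_boundedP[M [_ Mb]] : bounded_near f (nbhs (0 : X)).
  by apply: continuous_linear_bounded; exact: cdual_continuous.
exists (`|M| + 1) => _ [x /= x1 <-].
apply: (le_trans (Mb (`|M| + 1) _ x)).
  by rewrite (le_lt_trans (ler_norm M))// ltrDl.
by rewrite ler_piMr// addr_ge0.
Qed.

Let dual_norm_ub (f : cdual) x : `|x| <= 1 -> `|f x| <= dual_norm f.
Proof. by move=> x1; apply: ub_le_sup; [exact: dual_has_ubound|exists x]. Qed.

Let dual_norm_le (f : cdual) c :
  (forall x, `|x| <= 1 -> `|f x| <= c) -> dual_norm f <= c.
Proof.
move=> fc; apply: ge_sup; first by exists `|f 0|, 0 => //=; rewrite normr0.
by move=> _ [x /= x1 <-]; exact: fc.
Qed.

Fact dual_normD (f g : cdual) : dual_norm (f + g) <= dual_norm f + dual_norm g.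
Proof.
apply: dual_norm_le => x x1; apply: (le_trans (ler_normD _ _)).
by apply: lerD; exact: dual_norm_ub.
Qed.

Let dual_normZ_le (a : R) (f : cdual) :
  dual_norm (a *: f) <= `|a| * dual_norm f.
Proof.
apply: dual_norm_le => x x1; rewrite -[dual_fun _ _]/(a * f x) normrM.
by rewrite ler_wpM2l// dual_norm_ub.
Qed.

Fact dual_normZ (a : R) (f : cdual) : dual_norm (a *: f) = `|a| * dual_norm f.
Proof.
apply/eqP; rewrite eq_le dual_normZ_le /=.
have [->|a0] := eqVneq a 0.
  rewrite normr0 mul0r; apply: le_trans (dual_norm_ub (x := 0) _ _) => //.
  by rewrite normr0.
rewrite mulrC -ler_pdivlMr ?normr_gt0// mulrC -normfV.
by rewrite -{1}[f]scale1r -(mulVf a0) -scalerA dual_normZ_le.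
Qed.

Fact dual_norm_eq0 (f : cdual) : dual_norm f = 0 -> f = 0.
Proof.
move=> f0; apply/val_inj/funext => x /=.
have [->|x0] := eqVneq x 0; first by rewrite linear0.
have : `|f (`|x|^-1 *: x)| <= 0.
  rewrite -f0; apply: dual_norm_ub.
  by rewrite normrZ normfV normr_id mulVf// normr_eq0.
by rewrite normr_le0 linearZ mulf_eq0 invr_eq0 normr_eq0 (negPf x0) => /eqP.
Qed.

HB.instance Definition _ := Lmodule_isNormed.Build R cdual
  dual_normD dual_normZ dual_norm_eq0.

End Dual.

(* The canonical embedding of X into its bidual is onto. *)
Definition reflexive_space (R : realType) (X : normedModType R) : Prop :=
  forall phi : cdual (cdual X), exists x : X, forall f : cdual X, phi f = f x.

Section Rotund.
Variables (R : realType) (V : lmodType R).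

(* [N] is the norm under consideration: both the bound and the convergence of
   the sequence are with respect to [N]. *)
Definition two_rotund (N : V -> R) : Prop :=
  forall u : nat -> V,
    (forall n, N (u n) <= 1) ->
    N (u mn.1 + u mn.2) @[mn --> (\oo, \oo)] --> (2 : R) ->
    exists x : V, N (u n - x) @[n --> \oo] --> (0 : R).

End Rotund.

Section Bases.
Variables (R : realType) (Y : normedModType R) (e : nat -> Y).

Definition expansion (a : nat -> R) : nat -> Y :=
  series (fun j => a j *: e j).

Definition schauder_basis : Prop :=
  forall y : Y, exists! a : nat -> R, expansion a @ \oo --> y.

Definition unconditional_basis : Prop :=
  schauder_basis /\
  forall (a : nat -> R) (y : Y), expansion a @ \oo --> y ->
    forall s : nat -> nat, bijective s ->
      series (fun j => a (s j) *: e (s j)) @ \oo --> y.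

Definition seminormalized : Prop :=
  exists c C : R, 0 < c /\ forall j, c <= `|e j| <= C.

Definition one_unconditional : Prop :=
  forall (a : nat -> R) (s : nat -> bool) (y z : Y),
    expansion a @ \oo --> y ->
    expansion (fun j => (-1) ^+ s j * a j) @ \oo --> z ->
    `|z| <= `|y|.

End Bases.

(* The least element of [P], which is junk when [P] is empty. *)
Definition nat_min (P : set nat) : nat :=
  get [set k | P k /\ forall l, P l -> (k <= l)%N].

Section Families.
Variable S : choiceType.

(* The sequence (p(i))_{i >= 1} is represented by [p] with p(i) = p i.-1. *)
Definition Sbar := nat -> S.

Definition dist_seq (p q : Sbar) : nat :=
  nat_min [set k | (0 < k)%N /\ p k.-1 <> q k.-1].

Definition sharp (A : set Sbar) : nat :=
  nat_min [set k | exists p q, [/\ A p, A q, p <> q & k = dist_seq p q]].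

Definition admissible (F : nat -> set (set Sbar)) : Prop :=
  [/\ F 0%N = [set A | A = set0 \/ exists p, A = [set p]],
      forall j A, F j.+1 A -> finite_set A,
      forall j A B, F j.+1 A -> B `<=` A -> F j.+1 B,
      forall j, F j `<=` F j.+1
    & forall j A, F j.+1 A -> (exists p q, [/\ A p, A q & p <> q]) ->
        exists G : nat -> set Sbar,
          (forall i, (1 <= i <= sharp A)%N -> F j (G i)) /\
          A = \bigcup_(i in [set i | (1 <= i <= sharp A)%N]) G i].

End Families.

Section C00.
Variables (R : realType) (T : choiceType).

(* Scalar families are valued in [R^o] to get the pointwise module structure. *)
Definition supp (x : T -> R^o) : set T := [set p | x p != 0].

Definition is_c00 : {pred T -> R^o} := fun x => `[< finite_set (supp x) >].

Fact is_c00_submod_closed : submod_closed is_c00.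
Proof.
split=> [|a f g /asboolP ff /asboolP fg]; apply/asboolP.
  rewrite (_ : supp _ = set0) //; apply/seteqP; split=> p //=.
  by rewrite /supp /= -[(0 : T -> R^o) p]/(0 : R^o) eqxx.
apply: (@sub_finite_set _ _ (supp f `|` supp g)); last by rewrite finite_setU.
move=> p; rewrite /supp /= -[(a *: f + g) p]/(a *: f p + g p) => h.
have [f0|f0] := eqVneq (f p) 0; last by left.
by right; move: h; rewrite f0 scaler0 add0r.
Qed.

HB.instance Definition _ :=
  GRing.isSubmodClosed.Build R (T -> R^o) is_c00 is_c00_submod_closed.

Record c00 := C00 { c00_fun :> T -> R^o ; _ : c00_fun \in is_c00 }.

HB.instance Definition _ := [isSub for c00_fun].
HB.instance Definition _ := [Choice of c00 by <:].
HB.instance Definition _ := [SubChoice_isSubLmodule of c00 by <:].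

End C00.

(* [sort >=%R _] lists the non-increasing rearrangement a*_1, a*_2, ... from
   index 0 on; the terms beyond [size a], where a* is padded with zeros,
   vanish. *)
Definition day_seq (R : realType) (a : seq R) : R :=
  let b := sort >=%R [seq `|t| | t <- a] in
  Num.sqrt (\sum_(1 <= n < (size a).+1) 4 ^- n * b`_n.-1 ^+ 2).

Definition day_c00 (R : realType) (T : choiceType) (x : c00 R T) : R :=
  day_seq [seq x p | p <- fset_set (supp x)].

Section Norms.
Variables (R : realType) (S : choiceType) (F : nat -> set (set (Sbar S))).
Implicit Type x : c00 R (Sbar S).

Definition Theta (A : set (Sbar S)) x : R := \sum_(p \in A) `|x p|.

Definition norm_level (j : nat) x : R := sup [set Theta A x | A in F j].

Definition tri_level (j : nat) x : R :=
  sup [set r | exists (N : nat) (G : 'I_N -> set (Sbar S)),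
    [/\ forall i, F j (G i),
        forall i k, i != k -> G i `&` G k = set0
      & r = day_seq [seq Theta (G i) x | i <- enum 'I_N]]].

Definition norm_c00 (Y : normedModType R) (e : nat -> Y) x : R :=
  `| limn (series (fun j => (2 ^- j * norm_level j x) *: e j)) |.

End Norms.

Section Completion.
Variables (R : realType) (E : lmodType R) (X : completeNormedModType R).
Variable iota : {linear E -> X}.

(* Completions are unique up to isometric isomorphism, so X is given abstractly,
   with its embedding of E. *)
Definition is_completion (N : E -> R) : Prop :=
  (forall x : E, `|iota x| = N x) /\ dense (range iota).

(* The continuous extension of [N] along [iota]; it is unique since [iota] has
   dense range, and the value is junk if [N] has no such extension. *)
Definition extension (N : E -> R) : X -> R :=
  get [set g : X -> R | continuous g /\ forall x : E, g (iota x) = N x].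

End Completion.

Section StarNorm.
Variables (R : realType) (S : choiceType) (F : nat -> set (set (Sbar S))).
Variables (X : completeNormedModType R) (iota : {linear c00 R (Sbar S) -> X}).
Variable eps : nat -> R.

Definition day_ext : X -> R := extension iota (@day_c00 R (Sbar S)).

Definition tri_ext (j : nat) : X -> R := extension iota (@tri_level R S F j).

Definition star_series (x : X) : nat -> R :=
  series (fun j => eps j * tri_ext j x ^+ 2).

Definition norm_star (x : X) : R :=
  Num.sqrt (`|x| ^+ 2 + day_ext x ^+ 2 + limn (star_series x)).

Definition eps_fast : Prop :=
  [/\ forall j, 0 < eps j,
      eps @ \oo --> (0 : R),
      forall x, cvgn (star_series x)
    & exists c C : R, 0 < c /\
        forall x, c * `|x| <= norm_star x <= C * `|x|].

End StarNorm.

(* Main.v *)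
Require Import Defs.
From HB Require Import structures.
From mathcomp Require Import all_boot all_order all_algebra finmap.
From mathcomp Require Import all_classical all_reals all_analysis.
From mathcomp Require Import ring lra.
Import Order.TTheory GRing.Theory Num.Theory.
Import numFieldNormedType.Exports.
Local Open Scope classical_set_scope.
Local Open Scope ring_scope.
Set Implicit Arguments.
Unset Strict Implicit.
Unset Printing Implicit Defensive.

(** The equivalence rests on two arguments of different nature.

    A 2-rotund norm equivalent to the norm of [X] makes [X] reflexive
    ([two_rotund_reflexive]). Given [phi] in the bidual, scaled to have norm
    one, one picks unit functionals [f_ l] at which [phi] is within [8 ^- l] of
    one. A point of the unit ball at which [\sum 2 ^+ l *: f_ l + g] nearly
    takes the value that [phi] prescribes is nearly normed by [f_ l] for large
    [l], and [g] is at least about [phi g] there. Two points nearly normed by a common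
    functional have a sum of norm nearly two, so such points converge by
    rotundity. Their limit does not depend on [g], because alternating between
    two limits is again a sequence to which rotundity applies. This one limit
    dominates [phi] at every [g], hence represents [phi].

    Conversely let [X] be reflexive and [u] a sequence in the unit ball of the
    second norm with [u m + u n] of norm tending to two. All the terms of the
    sum of squares that defines that norm obey the parallelogram inequality, so
    the defect [2 p (u m) ^+ 2 + 2 p (u n) ^+ 2 - p (u m + u n) ^+ 2] tends to
    zero for each of them separately ([pgap_norm], [pgap_term]). Along an
    ultrafilter the sequence has a weak limit [x], by reflexivity; only the
    convergence of the coordinates is used afterwards. Points of [X] are handled
    through their coordinates [co], so that the combinatorics takes place on
    functions on [Sbar S].

    The heart is [levels_converge]: [u n - x] tends to zero in every level norm,
    by induction on the level. If [u m - x] is small at level [j], a member [A]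
    of the family of level [j.+1] on which it is not small has a large [sharp],
    for [A] is covered by [sharp A] members of level [j]; so [A] meets the
    essentially finite support of an earlier [u n] in at most one point
    ([separatedS]). A list of disjoint sets that is nearly optimal for
    [u n + u m] in the Day-type norm of that level hardly distinguishes [u n]
    from [u m], by the parallelogram identity. Each set in it therefore sees no
    more of [u m] than of [x], up to a small error, and the Day-type norm of
    [u m] does not exceed that of [x] in the limit ([separated_tri]). This
    forbids mass escaping to infinity: it could be inserted in a nearly optimal
    list for [x] at a bounded position, for a definite gain ([near_lev]).

    Finally the rotundity of [Y] makes the vectors of the level norms of [u n]
    converge, so they have uniformly small tails ([uniform_tails]), and
    convergence at each level becomes convergence in norm. Different ultrafilters
    give the same limit since the second norm is strictly convex, as the Day
    norm is ([tri_strict]); hence the sequence itself converges. *)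

(** * Weighted sums of squares and their rearrangements *)

Section Weights.
Variable R : realType.
Implicit Types (I J : eqType).

(** The weights of the Day norm are folded in by recursion. The list fixes the
    order of the entries, so that the Day norm becomes the largest value over
    all reorderings and no sorting is needed in estimates. *)
Fixpoint wsq I (f : I -> R) (s : seq I) : R :=
  if s is i :: s' then (f i ^+ 2 + wsq f s') / 4 else 0.

Definition wnorm I (f : I -> R) s : R := Num.sqrt (wsq f s).

Lemma wsq_ge0 I (f : I -> R) s : 0 <= wsq f s.
Proof.
by elim: s => //= i s IHs; rewrite divr_ge0 // addr_ge0 // sqr_ge0.
Qed.
Hint Resolve wsq_ge0 : core.

Lemma wnorm_ge0 I (f : I -> R) s : 0 <= wnorm f s.
Proof. exact: sqrtr_ge0. Qed.

Lemma sqr_wnorm I (f : I -> R) s : wnorm f s ^+ 2 = wsq f s.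
Proof. by rewrite sqr_sqrtr. Qed.

Lemma eq_wsq I (f g : I -> R) s :
  {in s, forall i, f i ^+ 2 = g i ^+ 2} -> wsq f s = wsq g s.
Proof.
elim: s => //= i s IHs fg; rewrite fg ?mem_head// IHs// => k ks.
by apply: fg; rewrite inE ks orbT.
Qed.

Lemma wsq_le I (f g : I -> R) s :
  {in s, forall i, 0 <= f i <= g i} -> wsq f s <= wsq g s.
Proof.
elim: s => //= i s IHs fg; rewrite ler_pM2r ?invr_gt0//.
apply: lerD; last by apply: IHs => k ks; apply: fg; rewrite inE ks orbT.
have /andP[f0 fgi] := fg i (mem_head _ _).
by rewrite ler_sqr// nnegrE// (le_trans f0).
Qed.

Lemma wnorm_le I (f g : I -> R) s :
  {in s, forall i, 0 <= f i <= g i} -> wnorm f s <= wnorm g s.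
Proof. by move=> fg; rewrite ler_sqrt// wsq_le. Qed.

Lemma wsqD I (f g : I -> R) s :
  wsq (fun i => f i + g i) s + wsq (fun i => f i - g i) s =
  2 * wsq f s + 2 * wsq g s.
Proof.
elim: s => [|i s IHs] /=; first by rewrite !mulr0 addr0.
transitivity ((2 * f i ^+ 2 + 2 * g i ^+ 2 + (2 * wsq f s + 2 * wsq g s)) / 4).
  by rewrite -IHs; field.
by field.
Qed.

Lemma wsq_map I J (h : J -> I) (f : I -> R) s :
  wsq f (map h s) = wsq (f \o h) s.
Proof. by elim: s => //= i s ->. Qed.

Lemma wsqZ I (c : R) (f : I -> R) s :
  wsq (fun i => c * f i) s = c ^+ 2 * wsq f s.
Proof. by elim: s => [|i s /= ->] /=; [rewrite mulr0|field]. Qed.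

Lemma wsq_const_le I (f : I -> R) s d :
  {in s, forall i, 0 <= f i <= d} -> 3 * wsq f s <= d ^+ 2.
Proof.
elim: s => [|i s IHs] /= fd; first by rewrite mulr0 sqr_ge0.
have {IHs} := IHs (fun k ks => fd k (mem_behead (s := i :: s) ks)).
have /andP[f0 fdi] := fd i (mem_head _ _).
by have : f i ^+ 2 <= d ^+ 2 by [rewrite ler_sqr// nnegrE// (le_trans f0)]; lra.
Qed.

(** Drives the triangle inequality of [wnorm], by induction on the list. *)
Lemma cauchy_schwarz2 (x y z t : R) :
  x * z + y * t <= Num.sqrt (x ^+ 2 + y ^+ 2) * Num.sqrt (z ^+ 2 + t ^+ 2).
Proof.
rewrite -sqrtrM; last by rewrite addr_ge0// sqr_ge0.
rewrite (le_trans (ler_norm _))// -sqrtr_sqr ler_sqrt.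
  rewrite -subr_ge0.
  rewrite (_ : _ - _ = (x * t - y * z) ^+ 2) ?sqr_ge0//; ring.
by rewrite mulr_ge0// addr_ge0// sqr_ge0.
Qed.

Lemma minkowski2 (x y z t : R) :
  Num.sqrt ((x + z) ^+ 2 + (y + t) ^+ 2) <=
  Num.sqrt (x ^+ 2 + y ^+ 2) + Num.sqrt (z ^+ 2 + t ^+ 2).
Proof.
rewrite -[leRHS]ger0_norm ?addr_ge0 ?sqrtr_ge0// -sqrtr_sqr ler_sqrt ?sqr_ge0//.
rewrite [leRHS]sqrrD !sqr_sqrtr ?addr_ge0 ?sqr_ge0//.
have := cauchy_schwarz2 x y z t; rewrite -mulr_natr; lra.
Qed.

Lemma wnorm_cons I (f : I -> R) i s :
  wnorm f (i :: s) = Num.sqrt (f i ^+ 2 + wnorm f s ^+ 2) / 2.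
Proof.
rewrite /wnorm /= sqr_sqrtr// sqrtrM ?addr_ge0 ?sqr_ge0//; congr (_ * _).
rewrite sqrtrV//; congr (_^-1).
by rewrite (_ : 4 = 2 ^+ 2) ?sqrtr_sqr ?ger0_norm//; ring.
Qed.

Lemma wnormD I (f g : I -> R) s :
  wnorm (fun i => f i + g i) s <= wnorm f s + wnorm g s.
Proof.
elim: s => [|i s IHs]; first by rewrite /wnorm /= sqrtr0 addr0.
rewrite !wnorm_cons -mulrDl ler_pM2r ?invr_gt0//.
apply: le_trans (minkowski2 _ _ _ _).
rewrite ler_sqrt ?addr_ge0 ?sqr_ge0// lerD2l ler_sqr ?nnegrE ?wnorm_ge0//.
by rewrite addr_ge0// wnorm_ge0.
Qed.

Lemma wnormZ I (c : R) (f : I -> R) s :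
  wnorm (fun i => c * f i) s = `|c| * wnorm f s.
Proof. by rewrite /wnorm wsqZ sqrtrM ?sqr_ge0// sqrtr_sqr. Qed.

Lemma wnorm_const_le I (f : I -> R) s d :
  0 <= d -> {in s, forall i, 0 <= f i <= d} -> wnorm f s <= d.
Proof.
move=> d0 fd; rewrite -[leRHS]ger0_norm// -sqrtr_sqr ler_sqrt ?sqr_ge0//.
by have := wsq_const_le fd; have := wsq_ge0 f s; lra.
Qed.

(** The elementary rearrangement step, to which sorting and partitioning reduce
    by induction on the list. *)
Lemma wsq_move I (f : I -> R) i s1 s2 :
  {in s1, forall k, 0 <= f i <= f k} ->
  wsq f (i :: s1 ++ s2) <= wsq f (s1 ++ i :: s2).
Proof.
elim: s1 => // k s1 IHs fi.
have /andP[fi0 fik] := fi k (mem_head _ _).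
have := IHs (fun l ls => fi l (mem_behead (s := k :: s1) ls)).
have : f i ^+ 2 <= f k ^+ 2 by rewrite ler_sqr// nnegrE// (le_trans fi0).
by rewrite /=; lra.
Qed.

Lemma wsq_sort I (f : I -> R) s : (forall i, 0 <= f i) ->
  wsq f s <= wsq f (sort (relpre f >=%R) s).
Proof.
move=> f0; set r := relpre f >=%R.
have rt : total r by move=> x y; exact: ge_total.
have rr : transitive r by move=> x y z; exact: ge_trans.
elim: s => //= i s IHs.
have : exists s1 s2, sort r s = s1 ++ s2 /\ all (fun k => f i <= f k) s1 /\
   all (fun k => f k <= f i) s2.
  have : sorted r (sort r s) by exact: sort_sorted.
  elim: (sort r s) => [_|k t IHt]; first by exists [::], [::].
  rewrite /= (path_sortedE rr) => /andP[kt st].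
  have [ki|ik] := leP (f k) (f i).
    exists [::], (k :: t); split => //; split => //=; rewrite ki /=.
    by apply: sub_all kt => l; rewrite /r /= => /le_trans; apply.
  have [s1 [s2 [-> [h1 h2]]]] := IHt st.
  by exists (k :: s1), s2; rewrite /= (ltW ik).
move=> [s1 [s2 [ss [h1 h2]]]].
have fE t : wsq f t = wsq id (map f t) by rewrite wsq_map.
have -> : wsq f (sort r (i :: s)) = wsq f (s1 ++ i :: s2).
  rewrite !fE; congr wsq; rewrite -sort_map.
  apply: (@sorted_eq _ >=%R).
  - exact: ge_trans.
  - exact: ge_anti.
  - exact: sort_sorted (@ge_total _ _) _.
  - have sr : sorted r (s1 ++ s2) by rewrite -ss; exact: sort_sorted.
    rewrite sorted_map /= -/r -cat_rcons.
    move: sr; rewrite !(sorted_pairwise rr) !pairwise_cat pairwise_rcons.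
    move=> /and3P[a1 -> ->]; rewrite -cats1 allrel_catl a1 allrel1l !andbT.
    by apply/andP; split; [apply: sub_all h2|apply: sub_all h1] => k.
  - rewrite perm_sort; apply: perm_map.
    rewrite -[i :: s2]cat1s perm_sym perm_catCA /= perm_cons -ss.
    by rewrite perm_sort.
apply: (@le_trans _ _ (wsq f (i :: s1 ++ s2))).
  by rewrite -ss /= ler_pM2r ?invr_gt0// lerD2l.
by apply: wsq_move => k /(allP h1); rewrite f0.
Qed.

Lemma day_seq_map I (f : I -> R) s : (forall i, 0 <= f i) ->
  day_seq (map f s) = wnorm f (sort (relpre f >=%R) s).
Proof.
move=> f0; rewrite /day_seq /wnorm; congr Num.sqrt.
rewrite -map_comp (eq_map (g := f)); last by move=> i /=; rewrite ger0_norm.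
rewrite size_map sort_map -(size_sort (relpre f >=%R) s).
rewrite -(wsq_map f id).
rewrite -(size_map f); elim: [seq f i | i <- _] => [|x t IHt] /=.
  by rewrite big_geq.
rewrite big_add1 /= big_nat_recl//= expr1 -IHt big_add1 /= mulrDl mulrC.
congr (_ + _); rewrite mulr_suml; apply: eq_bigr => k _.
by rewrite exprS invfM; ring.
Qed.

(** Since [wsq f s2] is at most [d ^+ 2 / 3], what is lost by shifting [s2] one
    place is at most [d ^+ 2] at the weight of the new entry. *)
Lemma wsq_insert I (f g : I -> R) i s1 s2 c d :
  {in s1 ++ s2, forall k, 0 <= f k <= g k} ->
  {in s2, forall k, f k <= d} -> 0 <= c <= g i ->
  wsq f (s1 ++ s2) + 4 ^- (size s1).+1 * (c ^+ 2 - d ^+ 2) <=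
  wsq g (s1 ++ i :: s2).
Proof.
elim: s1 => [|k s1 IHs] /= fg fd /andP[c0 cg].
  have h1 : 3 * wsq f s2 <= d ^+ 2.
    by apply: wsq_const_le => k ks; have /andP[-> _] := fg k ks; exact: fd.
  have h2 := wsq_le fg.
  have : c ^+ 2 <= g i ^+ 2 by rewrite ler_sqr// nnegrE// (le_trans c0).
  by rewrite expr1; lra.
have := IHs (fun l ls => fg l (mem_behead (s := k :: s1 ++ s2) ls)) fd.
rewrite c0 cg => /(_ isT).
have /andP[f0 fgk] := fg k (mem_head _ _).
have : f k ^+ 2 <= g k ^+ 2 by rewrite ler_sqr// nnegrE// (le_trans f0).
rewrite [4 ^+ (size s1).+2]exprS invfM; lra.
Qed.

Lemma wsq_filter I (f : I -> R) d s : (forall i, 0 <= f i) ->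
  wsq f s <= wsq f ([seq i <- s | d < f i] ++ [seq i <- s | ~~ (d < f i)]).
Proof.
move=> f0; elim: s => //= i s IHs; case: ifP => /= [_|/negbT di].
  by rewrite ler_pM2r ?invr_gt0// lerD2l.
apply: le_trans (wsq_move _ _); last first.
  move=> k; rewrite mem_filter f0 => /andP[dk _]; move: di dk.
  by rewrite -leNgt => /le_trans h /ltW /h.
by rewrite /= ler_pM2r ?invr_gt0// lerD2l.
Qed.

End Weights.

Section Gaps.
Variables (R : realType) (I : eqType).

Lemma wsq_gap (a b c : I -> R) i s1 s2 :
  {in s1 ++ s2, forall k, c k ^+ 2 <= 2 * a k ^+ 2 + 2 * b k ^+ 2} ->
  wsq c (s1 ++ i :: s2) +
    4 ^- (size s1).+1 * (2 * a i ^+ 2 + 2 * b i ^+ 2 - c i ^+ 2) <=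
  2 * wsq a (s1 ++ i :: s2) + 2 * wsq b (s1 ++ i :: s2).
Proof.
elim: s1 => [|k s1 IHs] /= cab.
  suff : wsq c s2 <= 2 * wsq a s2 + 2 * wsq b s2 by rewrite expr1; lra.
  elim: s2 cab => [|k s2 IHs] /= cab; first by lra.
  have := IHs (fun l ls => cab l (mem_behead (s := k :: s2) ls)).
  by have := cab k (mem_head _ _); lra.
have := IHs (fun l ls => cab l (mem_behead (s := k :: s1 ++ s2) ls)).
have := cab k (mem_head _ _).
by rewrite [4 ^+ (size s1).+2]exprS invfM; lra.
Qed.

End Gaps.

Section Rearrangement.
Variable R : realType.

Lemma day_seq_perm (l l' : seq R) : perm_eq l l' -> day_seq l = day_seq l'.
Proof.
move=> ll'; rewrite /day_seq (perm_size ll'); congr Num.sqrt.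
have -> // : sort >=%R [seq `|t| | t <- l] = sort >=%R [seq `|t| | t <- l'].
apply/perm_sortP; [exact: ge_total|exact: ge_trans|exact: ge_anti|exact: perm_map].
Qed.

Lemma day_seq_norm (l : seq R) : day_seq l = day_seq [seq `|t| | t <- l].
Proof.
rewrite /day_seq size_map.
have -> // : [seq `|t| | t <- [seq `|t| | t <- l]] = [seq `|t| | t <- l].
by rewrite -map_comp; apply: eq_map => t /=; rewrite normr_id.
Qed.

Lemma wsq_cat_le (I : eqType) (f : I -> R) s t : wsq f s <= wsq f (s ++ t).
Proof.
elim: s => [|i s IHs] /=; first exact: wsq_ge0.
by rewrite ler_pM2r ?invr_gt0// lerD2l.
Qed.

Lemma wsq_cat0 (I : eqType) (f : I -> R) s t : {in t, forall i, f i = 0} ->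
  wsq f (s ++ t) = wsq f s.
Proof.
move=> t0; elim: s => [|i s /= -> //]; elim: t t0 => //= i t IHt t0.
rewrite t0 ?mem_head// IHt ?expr0n ?addr0 ?mul0r// => k kt.
by apply: t0; rewrite inE kt orbT.
Qed.

End Rearrangement.

(** * Masses of functions on the members of a family *)

Section Mass.
Variables (R : realType) (T : choiceType).
Implicit Types (v w : T -> R) (A B G : set T).

(** [Theta] for arbitrary functions, so that it applies to the coordinates of
    the points of the completion. *)
Definition mass A v : R := \sum_(p \in A) `|v p|.

Lemma massE A v : finite_set A -> mass A v = \sum_(p <- fset_set A) `|v p|.
Proof. by move=> fA; rewrite /mass fsbig_finite. Qed.

Lemma mass_ge0 A v : 0 <= mass A v.
Proof. by rewrite /mass; apply: fsumr_ge0 => p _. Qed.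

Lemma mass0 v : mass set0 v = 0.
Proof. by rewrite /mass fsbig_set0. Qed.

Lemma mass1 p v : mass [set p] v = `|v p|.
Proof. by rewrite /mass fsbig_set1. Qed.

Lemma massD A v w : finite_set A -> mass A (v \+ w) <= mass A v + mass A w.
Proof.
by move=> fA; rewrite !massE// -big_split; apply: ler_sum => p _; exact: ler_normD.
Qed.

Lemma massZ A c v : finite_set A -> mass A (fun p => c * v p) = `|c| * mass A v.
Proof.
by move=> fA; rewrite !massE// mulr_sumr; apply: eq_bigr => p _; rewrite normrM.
Qed.

Lemma massID B A v : finite_set A -> mass A v = mass (A `&` B) v + mass (A `\` B) v.
Proof. by move=> fA; rewrite /mass (fsbigID B). Qed.

Lemma mass_le A B v : finite_set B -> A `<=` B -> mass A v <= mass B v.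
Proof.
move=> fB AB; rewrite (massID A _ fB) (setIidr AB) lerDl; exact: mass_ge0.
Qed.

Lemma eq_mass A v w : (forall p, A p -> `|v p| = `|w p|) -> mass A v = mass A w.
Proof. by move=> vw; rewrite /mass; apply: eq_fsbigr => p /set_mem/vw. Qed.

Lemma massC A v w : mass A (v \- w) = mass A (w \- v).
Proof. by apply: eq_mass => p _ /=; rewrite distrC. Qed.

Lemma mass_eq0 A v : (forall p, A p -> v p = 0) -> mass A v = 0.
Proof. by move=> v0; rewrite /mass fsbig1// => p Ap; rewrite v0// normr0. Qed.

Lemma massB A v w : finite_set A -> mass A v <= mass A w + mass A (v \- w).
Proof.
move=> fA; apply: le_trans (massD _ _ fA).
by rewrite (@eq_mass _ v (w \+ (v \- w)))// => p _ /=; rewrite addrC subrK.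
Qed.

Lemma mass_bigcup A (G : nat -> set T) k v : finite_set A ->
  (forall i, (1 <= i <= k)%N -> finite_set (G i)) ->
  A = \bigcup_(i in [set i | (1 <= i <= k)%N]) G i ->
  mass A v <= \sum_(1 <= i < k.+1) mass (G i) v.
Proof.
elim: k A => [|k IHk] A fA fG AE.
  rewrite big_geq// AE (_ : \bigcup_(i in _) _ = set0) ?mass0//.
  by apply/seteqP; split => // p [i /=]; rewrite andbC; case: i.
rewrite big_nat_recr//= (massID (G k.+1) _ fA).
have fGk : finite_set (G k.+1) by apply: fG; rewrite /= leqnn.
rewrite [leRHS]addrC; apply: lerD; first by apply: mass_le => //; exact: subIsetr.
have fA' : finite_set (A `\` G k.+1) by exact: finite_setD.
apply: (@le_trans _ _ (mass (\bigcup_(i in [set i | (1 <= i <= k)%N]) G i) v)).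
  apply: mass_le.
    apply: bigcup_finite; last by move=> i /= /andP[i1 ik]; apply: fG; rewrite i1 leqW.
    by apply: (@sub_finite_set _ _ `I_k.+1); [move=> i /= /andP[_]|exact: finite_II].
  move=> p [+ pG]; rewrite AE => -[i /= /andP[i1]].
  by rewrite leq_eqVlt => /orP[/eqP ->//|ik] Gp; exists i => //=; rewrite i1.
apply: IHk => //.
  apply: bigcup_finite; last by move=> i /= /andP[i1 ik]; apply: fG; rewrite i1 leqW.
  by apply: (@sub_finite_set _ _ `I_k.+1); [move=> i /= /andP[_]|exact: finite_II].
by move=> i /andP[i1 ik]; apply: fG; rewrite i1 leqW.
Qed.

End Mass.

Local Notation masses v := (fun G => mass G v).

Section Families.
Variables (R : realType) (T : choiceType) (Fj : set (set T)).
Implicit Types (v w : T -> R) (A B G : set T) (s : seq (set T)).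

Definition hereditary_family :=
  [/\ forall A, Fj A -> finite_set A,
      forall A B, Fj A -> B `<=` A -> Fj B,
      Fj set0
    & forall p, Fj [set p]].

Definition mass_bounded v := exists M, forall G, Fj G -> mass G v <= M.

(** What remains of finite support after passing to limits in a level norm: the
    coordinates of every point of the completion have this property. *)
Definition approximable v := forall eps, 0 < eps ->
  exists A, finite_set A /\ forall G, Fj G -> mass (G `\` A) v <= eps.

Definition lev v : R := sup [set mass G v | G in Fj].

(** Disjointness is phrased by counting, so that it is visibly insensitive to
    the order of the list. *)
Definition disjoint_list s :=
  (forall G, G \in s -> Fj G) /\ forall p, (count (fun G => p \in G) s <= 1)%N.

(** Ordered lists replace the rearrangement in the Day norm, because the
    supremum runs over all orders anyway. *)
Definition tri v : R := sup [set wnorm (masses v) s | s in disjoint_list].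

Hypothesis hF : hereditary_family.

Let fin A : Fj A -> finite_set A. Proof. by case: hF => + _ _ _; apply. Qed.
Let her A B : Fj A -> B `<=` A -> Fj B.
Proof. by case: hF => _ + _ _; apply. Qed.
Lemma approximable_bounded v : approximable v -> mass_bounded v.
Proof.
move=> /(_ 1 ltr01)[A [fA hA]]; exists (mass A v + 1) => G FG.
rewrite (massID A v (fin FG)) lerD ?hA//.
by apply: mass_le => //; exact: subIsetr.
Qed.

Let set0F : Fj set0. Proof. by case: hF. Qed.

Lemma mass_le_lev v G : mass_bounded v -> Fj G -> mass G v <= lev v.
Proof.
by move=> [M vM] FG; apply: ub_le_sup; [exists M => _ [H FH <-]; exact: vM|exists G].
Qed.

Lemma lev_le v M : (forall G, Fj G -> mass G v <= M) -> lev v <= M.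
Proof.
move=> vM; apply: ge_sup; first by exists (mass set0 v), set0.
by move=> _ [G FG <-]; exact: vM.
Qed.

Lemma lev_ge0 v : mass_bounded v -> 0 <= lev v.
Proof. by move=> bv; rewrite -(mass0 v); exact: mass_le_lev. Qed.

Lemma mass_boundedD v w : mass_bounded v -> mass_bounded w -> mass_bounded (v \+ w).
Proof.
move=> [M vM] [N wN]; exists (M + N) => G FG.
by apply: le_trans (massD _ _ (fin FG)) _; rewrite lerD// ?vM ?wN.
Qed.

Lemma levD v w : mass_bounded v -> mass_bounded w -> lev (v \+ w) <= lev v + lev w.
Proof.
move=> bv bw; apply: lev_le => G FG; apply: le_trans (massD _ _ (fin FG)) _.
by rewrite lerD// mass_le_lev.
Qed.

Lemma levB v w : mass_bounded v -> mass_bounded w -> lev (v \- w) <= lev v + lev w.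
Proof.
move=> bv bw; apply: lev_le => G FG; apply: le_trans (massB _ v (fin FG)) _.
have -> : mass G ((v \- w) \- v) = mass G w.
  by apply: eq_mass => p _ /=; rewrite addrAC subrr add0r normrN.
by rewrite lerD// mass_le_lev.
Qed.

Lemma nil_disjoint : disjoint_list [::]. Proof. by []. Qed.

Lemma wnorm_le_lev v s : mass_bounded v -> disjoint_list s ->
  wnorm (masses v) s <= lev v.
Proof.
move=> bv [sF _]; apply: wnorm_const_le; first exact: lev_ge0.
by move=> G /sF FG; rewrite mass_ge0 mass_le_lev.
Qed.

Lemma wnorm_le_tri v s : mass_bounded v -> disjoint_list s ->
  wnorm (masses v) s <= tri v.
Proof.
move=> bv gs; apply: ub_le_sup; last by exists s.
by exists (lev v) => _ [t gt <-]; exact: wnorm_le_lev.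
Qed.

Lemma tri_le v M : (forall s, disjoint_list s -> wnorm (masses v) s <= M) ->
  tri v <= M.
Proof.
move=> vM; apply: ge_sup; first by exists (wnorm (masses v) [::]), [::].
by move=> _ [s gs <-]; exact: vM.
Qed.

Lemma tri_ge0 v : mass_bounded v -> 0 <= tri v.
Proof.
move=> bv; apply: le_trans (wnorm_le_tri bv nil_disjoint); exact: wnorm_ge0.
Qed.

Lemma tri_le_lev v : mass_bounded v -> tri v <= lev v.
Proof. by move=> bv; apply: tri_le => s gs; exact: wnorm_le_lev. Qed.

Lemma wsq_le_tri v s : mass_bounded v -> disjoint_list s ->
  wsq (masses v) s <= tri v ^+ 2.
Proof.
move=> bv gs; rewrite -sqr_wnorm ler_sqr ?nnegrE ?wnorm_ge0 ?tri_ge0//.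
exact: wnorm_le_tri.
Qed.

Lemma wsq_massD v w s : disjoint_list s -> wsq (masses (v \+ w)) s <=
  wsq (fun G => mass G v + mass G w) s.
Proof.
move=> [sF _]; apply: wsq_le => G /sF FG.
by rewrite mass_ge0 massD//; exact: fin.
Qed.

Lemma triD v w : mass_bounded v -> mass_bounded w -> tri (v \+ w) <= tri v + tri w.
Proof.
move=> bv bw; apply: tri_le => s gs.
apply: (@le_trans _ _ (wnorm (fun G => mass G v + mass G w) s)).
  by rewrite ler_sqrt ?wsq_ge0// wsq_massD.
by apply: le_trans (wnormD _ _ _) _; rewrite lerD// wnorm_le_tri.
Qed.

Lemma triZ c v : mass_bounded v -> tri (fun p => c * v p) <= `|c| * tri v.
Proof.
move=> bv; apply: tri_le => s gs.
rewrite (_ : wnorm _ s = `|c| * wnorm (masses v) s); last first.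
  rewrite -(normr_id c) -wnormZ /wnorm; congr Num.sqrt.
  apply: eq_wsq => G Gs; rewrite massZ//.
  by apply: fin; case: gs => + _; apply.
by rewrite ler_wpM2l// wnorm_le_tri.
Qed.

Lemma tri_near v eps : mass_bounded v -> 0 < eps ->
  exists s, disjoint_list s /\ tri v ^+ 2 - eps < wsq (masses v) s.
Proof.
move=> bv e0; have t0 := tri_ge0 bv.
(* Small enough for [tri v ^+ 2 - eps < (tri v - d) ^+ 2]. *)
pose d := eps / (2 * tri v + 1).
have d0 : 0 < d by rewrite divr_gt0// ltr_wpDl// mulr_ge0.
have dE : d * (2 * tri v + 1) = eps by rewrite /d divfK// gt_eqF// ltr_wpDl// mulr_ge0.
have [|_ [s gs <-] ts] := sup_adherent d0 (E := [set wnorm (masses v) s | s in disjoint_list]).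
  split; first by exists (wnorm (masses v) [::]), [::].
  by exists (lev v) => _ [t gt <-]; exact: wnorm_le_lev.
exists s; split => //; rewrite -/(tri v) in ts.
rewrite -sqr_wnorm; have w0 := wnorm_ge0 (masses v) s.
have [td|td] := ltP (tri v) d.
  have : tri v ^+ 2 <= tri v * d by rewrite expr2 ler_wpM2l// ltW.
  have := sqr_ge0 (wnorm (masses v) s); nra.
have : (tri v - d) ^+ 2 <= wnorm (masses v) s ^+ 2.
  by rewrite ler_sqr ?nnegrE ?subr_ge0// ltW.
nra.
Qed.

(** At a fixed list [wsq] obeys the parallelogram identity, and [tri] dominates
    it for each of the three functions. So a list that is nearly optimal for
    [v + w] hardly distinguishes [v] from [w], and is nearly optimal for both. *)
Lemma tri_parallelogram v w eta s : mass_bounded v -> mass_bounded w ->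
  disjoint_list s -> tri (v \+ w) ^+ 2 - eta < wsq (masses (v \+ w)) s ->
  let Q := 2 * tri v ^+ 2 + 2 * tri w ^+ 2 - tri (v \+ w) ^+ 2 in
  wsq (fun G => mass G v - mass G w) s <= Q + eta /\
  tri w ^+ 2 - (Q + eta) / 2 <= wsq (masses w) s.
Proof.
move=> bv bw gs ts Q; have h1 := wsq_massD v w gs.
have h2 := wsqD (masses v) (masses w) s.
have h3 := wsq_le_tri bv gs; have h4 := wsq_le_tri bw gs.
have h5 := wsq_ge0 (fun G => mass G v - mass G w) s.
by rewrite /Q; split; lra.
Qed.

(** A set may see more of [w] than of [u], provided that it tells [v] and [w]
    apart by as much; a nearly optimal list for [v + w] contains little of this
    kind, so the excess disappears in the sum of squares. *)
Lemma tri_compare u v w eps rho : mass_bounded u -> mass_bounded v -> mass_bounded w ->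
  0 <= eps -> 0 < rho ->
  2 * tri v ^+ 2 + 2 * tri w ^+ 2 - tri (v \+ w) ^+ 2 <= rho ^+ 2 / 2 ->
  (forall G, Fj G -> mass G w <= mass G u + eps + `|mass G v - mass G w|) ->
  tri w <= tri u + eps + 2 * rho.
Proof.
move=> bu bv bw e0 r0 Qle cmp.
have r2 : 0 < rho ^+ 2 / 2 by rewrite divr_gt0// exprn_gt0.
have [s [gs ts]] := tri_near (mass_boundedD bv bw) r2.
have [dle wge] := tri_parallelogram bv bw gs ts.
set Q := _ - tri (v \+ w) ^+ 2 in Qle dle wge.
have u0 := tri_ge0 bu.
have w1 : wnorm (masses w) s <= tri u + eps + rho.
  apply: (@le_trans _ _ (wnorm (fun G => mass G u + (eps + `|mass G v - mass G w|)) s)).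
    apply: wnorm_le => G Gs; rewrite mass_ge0 addrA cmp//.
    by case: gs => + _; apply.
  apply: le_trans (wnormD _ _ _) _; rewrite -addrA lerD ?wnorm_le_tri//.
  apply: le_trans (wnormD _ _ _) _; rewrite lerD//.
    by apply: wnorm_const_le => // G _; rewrite e0 lexx.
  rewrite -[leRHS](ger0_norm (ltW r0)) -sqrtr_sqr ler_sqrt ?sqr_ge0//.
  rewrite (_ : wsq _ _ = wsq (fun G => mass G v - mass G w) s).
    by apply: le_trans dle _; lra.
  by apply: eq_wsq => G _; rewrite real_normK// num_real.
have : tri w ^+ 2 <= (tri u + eps + 2 * rho) ^+ 2.
  apply: (@le_trans _ _ (wnorm (masses w) s ^+ 2 + rho ^+ 2)).
    by rewrite sqr_wnorm; lra.
  have : wnorm (masses w) s ^+ 2 <= (tri u + eps + rho) ^+ 2.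
    by rewrite ler_sqr ?nnegrE ?wnorm_ge0 ?addr_ge0// ltW.
  nra.
by rewrite ler_sqr ?nnegrE ?tri_ge0// !addr_ge0// mulr_ge0// ltW.
Qed.

End Families.

(** * Inserting escaping mass in a nearly optimal list *)

Section Insertion.
Variables (R : realType) (T : choiceType) (Fj : set (set T)).
Implicit Types (v w : T -> R) (A B G : set T) (s : seq (set T)).
Hypothesis hF : hereditary_family Fj.

Let fin A : Fj A -> finite_set A. Proof. by case: hF => + _ _ _; apply. Qed.
Let her A B : Fj A -> B `<=` A -> Fj B.
Proof. by case: hF => _ + _ _; apply. Qed.

(** Double counting: each entry contains a point of [A], and each point of [A]
    lies in at most one entry. *)
Lemma size_disjoint s A : (forall p, (count (fun G => p \in G) s <= 1)%N) ->
  finite_set A -> (forall G, G \in s -> exists p, G p /\ A p) ->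
  (size s <= #|` fset_set A|)%N.
Proof.
move=> s1 fA sA; rewrite -sum1_size cardfE.
apply: (@leq_trans (\sum_(G <- s) \sum_(p <- fset_set A) (p \in G))%N).
  rewrite big_seq_cond [X in (_ <= X)%N]big_seq_cond.
  apply: leq_sum => G /andP[/sA[p [Gp Ap]] _].
  have pA : p \in fset_set A by rewrite in_fset_set// inE.
  by rewrite (big_rem _ pA)/= (mem_set Gp).
rewrite exchange_big /= -cardfE -(sum1_size (fset_set A)).
apply: leq_sum => p _; apply: leq_trans (s1 p).
by rewrite -big_mkcond /= sum1_count.
Qed.

Lemma disjoint_perm s t : perm_eq s t -> disjoint_list Fj s -> disjoint_list Fj t.
Proof.
move=> st [sF s1]; split=> [G Gt|p]; first by apply: sF; rewrite (perm_mem st).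
by rewrite -(permP st).
Qed.

Lemma disjoint_insert s1 s2 s G : perm_eq (s1 ++ s2) s -> disjoint_list Fj s ->
  Fj G -> (forall H p, H \in s -> H p -> ~ G p) -> disjoint_list Fj (s1 ++ G :: s2).
Proof.
move=> ps gs FG dG; apply: (@disjoint_perm (G :: s)).
  by rewrite perm_sym -cat1s perm_catCA /= perm_cons.
case: gs => sF s1'; split=> [H|p] /=.
  by rewrite inE => /orP[/eqP ->//|]; exact: sF.
have [pG|_] := boolP (p \in G); last exact: s1'.
rewrite (_ : count _ s = 0)//; apply/eqP; rewrite -leqn0 leqNgt -has_count.
by apply/hasP => -[H Hs /set_mem Hp]; apply: dG Hs Hp (set_mem pG).
Qed.

(** A nearly optimal list leaves no mass unused: only boundedly many of its
    entries are larger than [d / 2], so that an entry of size [d] could be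
    inserted at a bounded position, for a definite gain. *)
Lemma tri_insert v d : approximable Fj v -> 0 < d ->
  exists K g, 0 < g /\ forall s, disjoint_list Fj s ->
    tri Fj v ^+ 2 - g < wsq (masses v) s ->
    let s1 := [seq G <- s | d / 2 < mass G v] in
    let s2 := [seq G <- s | ~~ (d / 2 < mass G v)] in
    [/\ perm_eq (s1 ++ s2) s, (size s1 <= K)%N,
       tri Fj v ^+ 2 - g < wsq (masses v) (s1 ++ s2)
    & forall (f : set T -> R) G, (forall H, H \in s -> mass H v <= f H) ->
       d <= f G -> tri Fj v ^+ 2 + g < wsq f (s1 ++ G :: s2)].
Proof.
move=> av d0; have d20 : 0 < d / 2 by rewrite divr_gt0.
have [A [fA hA]] := av _ d20.
set K := #|` fset_set A|; pose g : R := 4 ^- K.+1 * (d ^+ 2 - (d / 2) ^+ 2) / 2.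
have dd : 0 < d ^+ 2 - (d / 2) ^+ 2.
  by rewrite (_ : _ - _ = 3 / 4 * d ^+ 2); [rewrite mulr_gt0// exprn_gt0|field].
exists K, g; split; first by rewrite /g divr_gt0// mulr_gt0// invr_gt0 exprn_gt0.
move=> s gs ts s1 s2; have ps : perm_eq (s1 ++ s2) s by rewrite /s1 /s2 perm_filterC.
have [tF t1] : disjoint_list Fj (s1 ++ s2).
  by apply: disjoint_perm gs; rewrite perm_sym.
have s1K : (size s1 <= K)%N.
  apply: size_disjoint => // [p|G].
    by have := t1 p; rewrite count_cat; apply: leq_trans; exact: leq_addr.
  move=> Gs1; apply: contrapT => GA; move: (Gs1); rewrite mem_filter => /andP[+ _].
  have FG : Fj G by apply: tF; rewrite mem_cat Gs1.
  have := hA _ FG; rewrite (_ : G `\` A = G); first by case: ltP.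
  by apply/seteqP; split=> [p []//|p Gp]; split => // Ap; apply: GA; exists p.
have ts' : tri Fj v ^+ 2 - g < wsq (masses v) (s1 ++ s2).
  apply: (lt_le_trans ts); rewrite /s1 /s2.
  by apply: wsq_filter => G; exact: mass_ge0.
split=> // f G fs fG.
have : wsq (masses v) (s1 ++ s2) + 4 ^- (size s1).+1 * (d ^+ 2 - (d / 2) ^+ 2) <=
    wsq f (s1 ++ G :: s2).
  apply: wsq_insert; last by rewrite (ltW d0).
    by move=> H; rewrite (perm_mem ps) mass_ge0 => /fs ->.
  by move=> H; rewrite mem_filter -leNgt => /andP[].
apply: lt_le_trans.
have gE : 2 * g = 4 ^- K.+1 * (d ^+ 2 - (d / 2) ^+ 2) by rewrite /g; field.
have : 2 * g <= 4 ^- (size s1).+1 * (d ^+ 2 - (d / 2) ^+ 2).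
  rewrite gE ler_pM2r// lef_pV2 ?posrE ?exprn_gt0//.
  by rewrite ler_weXn2l// ler1n.
lra.
Qed.

(** A nearly optimal list for [v \+ w] has [[set p]] at a bounded position, for
    it could be inserted otherwise. So the defect of the parallelogram
    inequality at this entry, which is [(v p - w p) ^+ 2], is small. *)
Lemma tri_strict_add v w p : Fj = [set A | A = set0 \/ exists q, A = [set q]] ->
  mass_bounded Fj v -> mass_bounded Fj w -> approximable Fj (v \+ w) ->
  2 * tri Fj v ^+ 2 + 2 * tri Fj w ^+ 2 <= tri Fj (v \+ w) ^+ 2 ->
  v p + w p != 0 -> v p = w p.
Proof.
move=> FE bv bw avw Q0 vwp; apply/eqP; rewrite -subr_eq0 -sqrf_eq0.
set u := v \+ w in avw Q0; have d0 : 0 < `|u p| by rewrite normr_gt0.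
have bu : mass_bounded Fj u by exact: mass_boundedD.
have Fp : Fj [set p] by case: hF.
have [K [g [g0 ins]]] := tri_insert avw d0.
rewrite eq_le sqr_ge0 andbT; apply/ler_addgt0Pr => eps e0; rewrite add0r.
pose g' := Num.min g (4 ^- K.+1 * eps).
have g'0 : 0 < g'.
  by rewrite /g' lt_min g0/= mulr_gt0// invr_gt0 exprn_gt0.
have [s [gs ts]] := tri_near hF bu g'0.
have ts' : tri Fj u ^+ 2 - g < wsq (masses u) s.
  by apply: le_lt_trans ts; rewrite lerD2l lerN2 ge_min lexx.
have [ps sK _ insf] := ins s gs ts'.
have tsf : tri Fj u ^+ 2 - g' < wsq (masses u)
    ([seq G <- s | `|u p| / 2 < mass G u] ++ [seq G <- s | ~~ (`|u p| / 2 < mass G u)]).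
  by apply: (lt_le_trans ts); apply: wsq_filter => G; exact: mass_ge0.
set s1 := [seq G <- s | _] in ps sK insf tsf; set s2 := [seq G <- s | _] in ps insf tsf.
have ps' : [set p] \in s.
  apply: contrapT => pNs.
  have gs' : disjoint_list Fj (s1 ++ [set p] :: s2).
    apply: (disjoint_insert ps gs Fp) => H q Hs Hq qp; apply: pNs.
    have := gs.1 _ Hs; rewrite FE => -[H0|[r Hr]]; first by rewrite H0 in Hq.
    by move: Hs Hq; rewrite Hr qp /= => rs pr; rewrite pr.
  have := insf (masses u) [set p] (fun _ _ => lexx _).
  rewrite mass1 => /(_ (lexx _)).
  have := wsq_le_tri hF bu gs'; lra.
have ps1 : [set p] \in s1.
  rewrite mem_filter ps' andbT mass1; lra.
have [t1 [t2 s1E]] : exists t1 t2, s1 = t1 ++ [set p] :: t2.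
  by case/splitPr: ps1 => t1 t2; exists t1, t2.
have gss : disjoint_list Fj (t1 ++ [set p] :: t2 ++ s2).
  by apply: disjoint_perm gs; rewrite perm_sym -cat_cons catA -s1E.
rewrite s1E -catA cat_cons in tsf.
have h1 := wsq_le_tri hF bv gss; have h2 := wsq_le_tri hF bw gss.
have h0 : {in t1 ++ (t2 ++ s2), forall H,
    (masses u) H ^+ 2 <= 2 * (masses v) H ^+ 2 + 2 * (masses w) H ^+ 2}.
  move=> H Hs; have FH : Fj H.
    apply: gss.1; rewrite mem_cat inE.
    by move: Hs; rewrite !mem_cat => /orP[->|->]; rewrite ?orbT.
  have : mass H u ^+ 2 <= (mass H v + mass H w) ^+ 2.
    by rewrite ler_sqr ?nnegrE ?addr_ge0 ?mass_ge0// massD//; exact: fin.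
  have := sqr_ge0 (mass H v - mass H w); lra.
have := wsq_gap [set p] h0; rewrite /= !mass1 !real_normK ?num_real// /u /=.
rewrite (_ : _ - (v p + w p) ^+ 2 = (v p - w p) ^+ 2); last by ring.
move=> h3.
have g'le : g' <= 4 ^- K.+1 * eps by rewrite ge_min lexx orbT.
have h4 : 4 ^- (size t1).+1 * (v p - w p) ^+ 2 <= 4 ^- K.+1 * eps.
  by move: tsf Q0 h1 h2 h3 g'le; lra.
have h5 : 4 ^- K.+1 * eps <= 4 ^- (size t1).+1 * eps.
  rewrite ler_pM2r// lef_pV2 ?posrE ?exprn_gt0// ler_weXn2l ?ler1n//.
  by apply: leq_trans sK; rewrite s1E size_cat leq_addr.
by have := le_trans h4 h5; rewrite ler_pM2l// invr_gt0 exprn_gt0.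
Qed.

Lemma approximableD v w : approximable Fj v -> approximable Fj w ->
  approximable Fj (v \+ w).
Proof.
move=> av aw eps e0; have e20 : 0 < eps / 2 by rewrite divr_gt0.
have [A [fA hA]] := av _ e20; have [B [fB hB]] := aw _ e20.
exists (A `|` B); split=> [|G FG]; first by rewrite finite_setU.
have FA : Fj (G `\` A) by apply: her FG _; exact: subDsetl.
have FB : Fj (G `\` B) by apply: her FG _; exact: subDsetl.
have FAB : Fj (G `\` (A `|` B)) by apply: her FG _; exact: subDsetl.
apply: le_trans (massD _ _ (fin FAB)) _; rewrite (splitr eps) lerD//.
  by apply: le_trans (hA _ FG); apply: mass_le (fin FA) _ => p [Gp /not_orP[]].
by apply: le_trans (hB _ FG); apply: mass_le (fin FB) _ => p [Gp /not_orP[]].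
Qed.

Lemma approximableZ c v : approximable Fj v -> approximable Fj (fun p => c * v p).
Proof.
move=> av eps e0; have c0 : 0 < `|c| + 1 by rewrite ltr_wpDl.
have [A [fA hA]] := av _ (divr_gt0 e0 c0).
exists A; split=> // G FG; have FA : Fj (G `\` A) by apply: her FG _; exact: subDsetl.
rewrite (massZ _ _ (fin FA)); apply: (@le_trans _ _ ((`|c| + 1) * mass (G `\` A) v)).
  by rewrite ler_wpM2r ?mass_ge0// lerDl.
by rewrite mulrC -ler_pdivlMr// hA.
Qed.

(** Where [v] and [w] cancel without vanishing, equality for the pair [v, w]
    passes to the pair [(v + w) / 2, v], which does not cancel there. *)
Lemma tri_strict v w : Fj = [set A | A = set0 \/ exists q, A = [set q]] ->
  approximable Fj v -> approximable Fj w ->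
  2 * tri Fj v ^+ 2 + 2 * tri Fj w ^+ 2 <= tri Fj (v \+ w) ^+ 2 -> v =1 w.
Proof.
move=> FE av aw Q0 p.
have bv := approximable_bounded hF av; have bw := approximable_bounded hF aw.
have avw := approximableD av aw.
have [vw0|vw0] := eqVneq (v p + w p) 0; last exact: (tri_strict_add FE bv bw avw).
pose u q := 2^-1 * (v \+ w) q.
have au : approximable Fj u by exact: approximableZ.
have bu := approximable_bounded hF au.
suff : u p = v p by rewrite /u /= vw0 mulr0 => v0; move: vw0; rewrite -v0 add0r.
have [v0|v0] := eqVneq (v p) 0; first by rewrite /u /= vw0 mulr0 v0.
apply: (tri_strict_add FE bu bv (approximableD au av)); last first.
  by rewrite /u /= vw0 mulr0 add0r.
have buv := mass_boundedD hF bu bv; have buw := mass_boundedD hF bu bw.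
have h1 : tri Fj (v \+ w) <= 2 * tri Fj u.
  rewrite (_ : v \+ w = fun q => 2 * u q).
    by apply: le_trans (triZ hF _ bu) _; rewrite ger0_norm.
  by apply/funext => q; rewrite /u mulrA mulfV// mul1r.
have h2 : 4 * tri Fj u <= tri Fj (u \+ v) + tri Fj (u \+ w).
  rewrite -ler_pdivlMl//; apply: (@le_trans _ _ (4^-1 * tri Fj ((u \+ v) \+ (u \+ w)))).
    rewrite {1}(_ : u = fun q => 4^-1 * ((u \+ v) \+ (u \+ w)) q).
      apply: le_trans (triZ hF _ (mass_boundedD hF buv buw)) _.
      by rewrite ger0_norm// invr_ge0.
    by apply/funext => q /=; rewrite /u /=; field.
  by rewrite ler_pM2l ?invr_gt0//; exact: triD.
have h3 := triD hF bu bw.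
have u0 := tri_ge0 hF bu; have v0' := tri_ge0 hF bv; have w0 := tri_ge0 hF bw.
have vw' := tri_ge0 hF (approximable_bounded hF avw).
set a := tri Fj v in Q0 v0' *; set b := tri Fj w in Q0 h3 w0.
set m := tri Fj u in h1 h2 h3 u0 *; set c := tri Fj (v \+ w) in Q0 h1 vw'.
have h4 : c <= a + b by exact: triD.
have cm : c ^+ 2 <= (2 * m) ^+ 2 by rewrite ler_sqr// ?nnegrE mulr_ge0.
have cab : c ^+ 2 <= (a + b) ^+ 2 by rewrite ler_sqr ?nnegrE// addr_ge0.
have ab : a = b.
  have : (a - b) ^+ 2 <= 0 by nra.
  by rewrite le_eqVlt ltNge sqr_ge0 orbF sqrf_eq0 subr_eq0 => /eqP.
have am : a <= m.
  by rewrite -ler_sqr ?nnegrE//; move: cm Q0; rewrite -ab; nra.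
have ma : m <= a.
  have : 2 * m <= c.
    rewrite -ler_pdivlMl// -[2^-1]ger0_norm ?invr_ge0//.
    exact: triZ (approximable_bounded hF avw).
  by move: h4; rewrite -ab; lra.
have h5 : 2 * m <= tri Fj (u \+ v) by move: h2 h3 ma; rewrite -ab; lra.
have : (2 * m) ^+ 2 <= tri Fj (u \+ v) ^+ 2.
  by rewrite ler_sqr ?nnegrE ?mulr_ge0// (le_trans _ h5)// mulr_ge0.
have : a ^+ 2 <= m ^+ 2 by rewrite ler_sqr ?nnegrE.
nra.
Qed.

Variables (U : set_system nat) (PU : ProperFilter U).

Definition pointwise (v_ : nat -> T -> R) v := forall p eps, 0 < eps ->
  \forall n \near U, `|v_ n p - v p| <= eps.

Lemma near_mass (v_ : nat -> T -> R) v B eps : pointwise v_ v -> finite_set B -> 0 < eps ->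
  \forall n \near U, mass B (v_ n \- v) <= eps.
Proof.
move=> pv fB; have fE n : mass B (v_ n \- v) = \sum_(p <- fset_set B) `|(v_ n \- v) p|.
  exact: massE.
under eq_near do rewrite fE.
elim: (_ (fset_set B)) eps => [|p s IHs] eps e0.
  by near=> n; rewrite big_nil ltW.
have e20 : 0 < eps / 2 by rewrite divr_gt0.
near=> n; rewrite big_cons (splitr eps) lerD//.
  by near: n; exact: pv.
by near: n; exact: IHs.
Unshelve. all: by end_near. Qed.

(** Mass of [v_ n] escaping to infinity could be inserted in a nearly optimal
    list for [v], so that [tri] at [v_ n] would exceed [tri] at [v] by a definite
    amount. *)
Lemma near_lev (v_ : nat -> T -> R) v : approximable Fj v ->
  (forall n, mass_bounded Fj (v_ n)) ->
  pointwise v_ v ->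
  (forall rho, 0 < rho -> \forall n \near U, tri Fj (v_ n) <= tri Fj v + rho) ->
  forall d, 0 < d -> \forall n \near U, forall G, Fj G -> mass G (v_ n \- v) <= d.
Proof.
move=> av bv_ pv tv d d0; have bv := approximable_bounded hF av.
have d20 : 0 < d / 2 by rewrite divr_gt0.
have d40 : 0 < d / 4 by rewrite divr_gt0.
have [A [fA hA]] := av _ d40.
have [K [g [g0 ins]]] := tri_insert av d20.
have t0 := tri_ge0 hF bv; set t := tri Fj v in tv ins t0.
(* Small enough for [(t + 2 * rho) ^+ 2 <= t ^+ 2 + g]. *)
pose rho := Num.min 1 (g / (4 * t + 5)).
have t50 : 0 < 4 * t + 5 by rewrite ltr_wpDl// mulr_ge0.
have r0 : 0 < rho by rewrite lt_min ltr01/= divr_gt0.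
have r1 : rho <= 1 by rewrite ge_min lexx.
have rg : rho * (4 * t + 5) <= g by rewrite -ler_pdivlMr// ge_min lexx orbT.
have [s [gs ts]] := tri_near hF bv g0.
have [ps _ _ insf] := ins s gs ts.
set s1 := [seq G <- s | _] in ps insf; set s2 := [seq G <- s | _] in ps insf.
pose B := A `|` \bigcup_(G in [set` s]) G.
have fB : finite_set B.
  rewrite finite_setU; split=> //; apply: bigcup_finite => // G /= Gs.
  by apply: fin; exact: gs.1.
pose r := Num.min rho (d / 4).
have rr0 : 0 < r by rewrite lt_min r0.
near=> n => G FG; rewrite leNgt; apply/negP => dG.
have nB : mass B (v_ n \- v) <= r by near: n; exact: near_mass.
have nt : tri Fj (v_ n) <= t + rho by near: n; exact: tv.
have rrho : r <= rho by rewrite ge_min lexx.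
have rd : r <= d / 4 by rewrite ge_min lexx orbT.
pose H := G `\` B; have FH : Fj H by apply: her FG _; exact: subDsetl.
have Hd : d / 2 <= mass H (v_ n).
  have h1 := massID B (v_ n \- v) (fin FG).
  have h2 : mass (G `&` B) (v_ n \- v) <= mass B (v_ n \- v).
    by apply: mass_le => //; exact: subIsetr.
  have h3 := massB (v_ n \- v) (v_ n) (fin FH).
  have h4 : mass H ((v_ n \- v) \- v_ n) = mass H v.
    by apply: eq_mass => p _ /=; rewrite addrAC subrr add0r normrN.
  have h5 : mass H v <= mass (G `\` A) v.
    apply: mass_le; first by apply: fin; apply: her FG _; exact: subDsetl.
    by move=> p [Gp /not_orP[]].
  have := hA _ FG; rewrite -/H in h1; lra.
have gs' : disjoint_list Fj (s1 ++ H :: s2).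
  apply: (disjoint_insert ps gs FH) => L p Ls Lp [_]; apply; right.
  by exists L.
have lt1 : t ^+ 2 + g < wsq (fun G => mass G (v_ n) + rho) (s1 ++ H :: s2).
  apply: insf; last by rewrite (le_trans Hd)// lerDl ltW.
  move=> L Ls; have FL : Fj L by exact: gs.1.
  apply: le_trans (massB v (v_ n) (fin FL)) _; rewrite lerD2l massC.
  apply: le_trans rrho; apply: le_trans nB; apply: mass_le => // p Lp.
  by right; exists L.
have lt2 : wnorm (fun G => mass G (v_ n) + rho) (s1 ++ H :: s2) <= t + 2 * rho.
  apply: le_trans (wnormD _ _ _) _; rewrite mulr_natl mulr2n addrA lerD//.
    by apply: le_trans nt; exact: wnorm_le_tri.
  by apply: wnorm_const_le => [|? _]; rewrite ?lexx ?(ltW r0).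
have : wnorm (fun G => mass G (v_ n) + rho) (s1 ++ H :: s2) ^+ 2 <= (t + 2 * rho) ^+ 2.
  by rewrite ler_sqr ?nnegrE ?wnorm_ge0// addr_ge0// mulr_ge0// ltW.
by rewrite sqr_wnorm; nra.
Unshelve. all: by end_near. Qed.

End Insertion.

(** * Passing from one level to the next *)

Section Separation.
Variables (R : realType) (T : choiceType) (Fj : set (set T)).
Hypothesis hF : hereditary_family Fj.
Variables (U : set_system nat) (PU : ProperFilter U).
Variables (v_ : nat -> T -> R) (v : T -> R).

Let fin A : Fj A -> finite_set A. Proof. by case: hF => + _ _ _; apply. Qed.
Let her A B : Fj A -> B `<=` A -> Fj B.
Proof. by case: hF => _ + _ _; apply. Qed.

Definition parallelogram_small := forall eps, 0 < eps ->
  \forall n \near U, \forall m \near U,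
  2 * tri Fj (v_ n) ^+ 2 + 2 * tri Fj (v_ m) ^+ 2 - tri Fj (v_ n \+ v_ m) ^+ 2 <= eps.

(** The gliding hump condition. The finite set comes after [n] because it will
    be the essential support of [v_ n], and [m] comes after the finite set. *)
Definition mass_separated := forall eps, 0 < eps ->
  \forall n \near U, forall A, finite_set A -> \forall m \near U,
  forall G, Fj G -> mass G (v_ m \- v) <= eps \/ mass (G `&` A) (v_ n \- v) <= eps.

(** A set on which [v_ m] exceeds the limit sees [v_ n] close to the limit, so
    it tells [v_ n] and [v_ m] apart: this is the situation of [tri_compare]. *)
Lemma separated_tri : (forall n, approximable Fj (v_ n)) -> approximable Fj v ->
  parallelogram_small -> mass_separated ->
  forall rho, 0 < rho -> \forall n \near U, tri Fj (v_ n) <= tri Fj v + rho.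
Proof.
move=> av_ av par sep rho r0.
have bv := approximable_bounded hF av; have bv_ n := approximable_bounded hF (av_ n).
have r4 : 0 < rho / 4 by rewrite divr_gt0.
have r2 : 0 < (rho / 4) ^+ 2 / 2 by rewrite divr_gt0// exprn_gt0.
have [n [parn sepn]] := filter_ex (filterI (par _ r2) (sep _ r4)).
have [A [fA hA]] := av_ n _ r4.
near=> m; have : tri Fj (v_ m) <= tri Fj v + 2 * (rho / 4) + 2 * (rho / 4).
  apply: (tri_compare hF bv (bv_ n) (bv_ m)) => //; first by rewrite mulr_ge0// ltW.
    by near: m.
  move=> G FG; have GF := fin FG.
  have [h|h] : mass G (v_ m \- v) <= rho / 4 \/ mass (G `&` A) (v_ n \- v) <= rho / 4.
    by move: G FG {GF}; near: m; exact: sepn.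
    have := massB (v_ m) v GF; have := normr_ge0 (mass G (v_ n) - mass G (v_ m)).
    lra.
  have h1 := hA _ FG; have h2 := massID A (v_ n) GF.
  have h3 : mass (G `&` A) (v_ n) <= mass (G `&` A) v + mass (G `&` A) (v_ n \- v).
    by apply: massB; apply: fin; apply: her FG _; exact: subIsetl.
  have h4 : mass (G `&` A) v <= mass G v by apply: mass_le => //; exact: subIsetl.
  have := ler_norm (mass G (v_ m) - mass G (v_ n)); rewrite distrC; lra.
lra.
Unshelve. all: by end_near. Qed.

End Separation.

Section Sharp.
Variable S : choiceType.
Implicit Types (p q : Sbar S) (A : set (Sbar S)).

Lemma nat_minP (P : set nat) k : P k ->
  P (nat_min P) /\ forall l, P l -> (nat_min P <= l)%N.
Proof.
move=> Pk; rewrite /nat_min; apply: (@getPex _ [set k | P k /\ forall l, P l -> (k <= l)%N]).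
have /ex_minnP[m /asboolP Pm mmin] : exists m, `[< P m >] by exists k; apply/asboolP.
by exists m; split=> // l Pl; apply: mmin; apply/asboolP.
Qed.

Lemma sharp_le A p q : A p -> A q -> p <> q -> (sharp A <= dist_seq p q)%N.
Proof.
move=> Ap Aq pq; rewrite /sharp.
by apply: (nat_minP _).2; exists p, q.
Qed.

End Sharp.

Section Levels.
Variables (R : realType) (S : choiceType) (F : nat -> set (set (Sbar S))).
Hypothesis adm : admissible F.

Lemma admissible_mono i j : (i <= j)%N -> F i `<=` F j.
Proof.
case: adm => _ _ _ FS _; elim: j => [|j IHj]; first by rewrite leqn0 => /eqP->.
by rewrite leq_eqVlt => /orP[/eqP->//|ij] A /(IHj ij); exact: FS.
Qed.

Lemma admissible_hereditary j : hereditary_family (F j).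
Proof.
have [F0 Ffin Fher FS _] := adm.
have F00 : F 0%N set0 by rewrite F0; left.
have F01 p : F 0%N [set p] by rewrite F0; right; exists p.
split.
- case: j => [|j] A; last exact: Ffin.
  by rewrite F0 => -[->|[p ->]]; [exact: finite_set0|exact: finite_set1].
- case: j => [|j] A B; last exact: Fher.
  rewrite F0 => -[->|[p ->]] BA; first by left; apply/seteqP; split.
  have [Bp|Bp] := pselect (B p); [right; exists p|left]; apply/seteqP; split=> //.
    by move=> q ->.
  by move=> q Bq; apply: Bp; rewrite -(BA q Bq).
- exact: admissible_mono F00.
- by move=> p; exact: admissible_mono (F01 p).
Qed.

(** The distance of any two points of [G] bounds [sharp G], the number of
    members of the lower family that cover [G]. *)
Lemma mass_sharp j G p q (u : Sbar S -> R) c : F j.+1 G -> G p -> G q -> p <> q ->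
  0 <= c -> (forall H, F j H -> mass H u <= c) ->
  mass G u <= (dist_seq p q)%:R * c.
Proof.
move=> FG Gp Gq pq c0 uc; have [_ _ _ _ split_] := adm.
have [|H [FH GE]] := split_ _ _ FG; first by exists p, q.
have fG : finite_set G by case: (admissible_hereditary j.+1) => + _ _ _; exact.
have fH i : (1 <= i <= sharp G)%N -> finite_set (H i).
  by move=> /FH; case: (admissible_hereditary j) => + _ _ _; exact.
apply: le_trans (mass_bigcup u fG fH GE) _.
apply: (@le_trans _ _ (\sum_(1 <= i < (sharp G).+1) c)).
  rewrite big_nat_cond [leRHS]big_nat_cond; apply: ler_sum => i /andP[/andP[i1 i2] _].
  by apply: uc; apply: FH; rewrite i1 -ltnS.
rewrite sumr_const_nat subn1 /= -[leLHS]mulr_natl ler_wpM2r// ler_nat.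
exact: sharp_le.
Qed.

Variables (U : set_system nat) (PU : ProperFilter U).
Variables (v_ : nat -> Sbar S -> R) (v : Sbar S -> R).
Hypotheses (av_ : forall j n, approximable (F j) (v_ n))
  (av : forall j, approximable (F j) v) (pv : pointwise U v_ v).

Lemma separated0 : mass_separated (F 0%N) U v_ v.
Proof.
move=> eps e0; near=> n => A fA; near=> m => G.
have [-> _ _ _ _] := adm => -[->|[p ->]]; first by left; rewrite mass0 ltW.
have [Ap|Ap] := pselect (A p).
  left; rewrite mass1; have : mass A (v_ m \- v) <= eps by near: m; exact: near_mass.
  by apply: le_trans; rewrite -mass1; apply: mass_le => // q ->.
by right; rewrite mass_eq0 ?ltW// => q [-> /Ap].
Unshelve. all: by end_near. Qed.

(** If [G] has two points in [A], then [sharp G] is bounded in terms of [A], and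
    smallness of [v_ m \- v] passes from level [j] to [G]. Otherwise [G] has at
    most one point in [A], and such sets already belong to level [j]. *)
Lemma separatedS j :
  (forall d, 0 < d -> \forall n \near U, forall G, F j G -> mass G (v_ n \- v) <= d) ->
  mass_separated (F j.+1) U v_ v.
Proof.
move=> small eps e0; near=> n => A fA.
pose D := (\sum_(p <- fset_set A) \sum_(q <- fset_set A) dist_seq p q)%N.
have D0 : 0 < eps / D.+1%:R by rewrite divr_gt0.
near=> m => G FG.
have [[p [q [Gp [Gq [Ap [Aq pq]]]]]]|one] :=
  pselect (exists p q, G p /\ G q /\ A p /\ A q /\ p <> q).
  left; have : mass G (v_ m \- v) <= (dist_seq p q)%:R * (eps / D.+1%:R).
    apply: (mass_sharp FG Gp Gq pq (ltW D0)).
    by near: m; exact: (small _ D0).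
  move=> /le_trans; apply; rewrite mulrA ler_pdivrMr// mulrC ler_wpM2l ?(ltW e0)//.
  rewrite ler_nat leqW// /D (big_rem p) ?in_fset_set ?inE//=.
  rewrite (big_rem q) ?in_fset_set ?inE//= -addnA leq_addr//.
right; have : F j (G `&` A).
  apply: (admissible_mono (leq0n j)); have [-> _ _ _ _] := adm.
  have [[p [Gp Ap]]|e] := pselect (exists p, G p /\ A p); last first.
    by left; apply/seteqP; split=> // p [Gp Ap]; apply: e; exists p.
  right; exists p; apply/seteqP; split=> [q [Gq Aq]|q ->] //.
  by apply: contrapT => qp; apply: one; exists q, p.
by move: (G `&` A); near: n; exact: (small _ e0).
Unshelve. all: by end_near. Qed.

Hypothesis par : forall j, parallelogram_small (F j) U v_.

(** By induction on the level: smallness at one level confines, at the next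
    one, the sets that see [v_ m] away from the limit to small neighbourhoods,
    which is what [mass_separated] asks for. *)
Lemma levels_converge j d : 0 < d ->
  \forall n \near U, forall G, F j G -> mass G (v_ n \- v) <= d.
Proof.
elim: j d => [|j IHj] d d0; have hF := admissible_hereditary; apply: near_lev => //.
- by move=> n; exact: (approximable_bounded (hF _) (av_ _ n)).
- exact: (separated_tri (hF _) PU (av_ _) (av _) (par _) separated0).
- by move=> n; exact: (approximable_bounded (hF _) (av_ _ n)).
- exact: (separated_tri (hF _) PU (av_ _) (av _) (par _) (separatedS IHj)).
Qed.

End Levels.

(** * Limits of sequences, ultrafilters and bounded functionals *)

Section DoubleLimits.
Variable R : realType.

Lemma cvg_pairP (f : nat -> nat -> R) (l : R) :
  f mn.1 mn.2 @[mn --> (\oo, \oo)] --> l <->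
  forall eps, 0 < eps -> exists K : nat, forall m n, (K <= m)%N -> (K <= n)%N ->
    `|l - f m n| <= eps.
Proof.
split=> [/cvgrPdist_le h eps /h[[/= A B] [/= [K _ hA] [L _ hB]] AB]|h].
  exists (maxn K L) => m n; rewrite !geq_max => /andP[Km Lm] /andP[Kn Ln].
  by have := AB (m, n); apply; split; [exact: hA|exact: hB].
apply/cvgrPdist_le => eps /h[K hK].
exists ([set m | (K <= m)%N], [set m | (K <= m)%N]) => /=.
  by split; exists K.
by move=> [m n] /= [Km Kn]; exact: hK.
Qed.

Lemma cvg_seqP (V : normedModType R) (f : nat -> V) (l : V) :
  f n @[n --> \oo] --> l <->
  forall eps, 0 < eps -> exists K : nat, forall n, (K <= n)%N -> `|l - f n| <= eps.
Proof.
split=> [/cvgrPdist_le h eps /h[K _ hK]|h]; first by exists K.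
by apply/cvgrPdist_le => eps /h[K hK]; exists K.
Qed.

Lemma cauchy_seq_cvg (V : completeNormedModType R) (f : nat -> V) :
  (forall eps, 0 < eps -> exists K : nat, forall m n, (K <= m)%N -> (K <= n)%N ->
    `|f m - f n| <= eps) -> cvgn f.
Proof.
move=> hf; apply: cauchy_cvg; apply: cauchy_exP => eps e0.
have [K hK] := hf _ (divr_gt0 e0 (ltr0n R 2)).
exists (f K); exists K => // n /= Kn; rewrite /= -ball_normE /=.
by apply: le_lt_trans (hK K n _ Kn) _ => //; rewrite ltr_pdivrMr// ltr_pMr// ltr1n.
Qed.

Lemma cvg_norm_le (V : normedModType R) (f : nat -> V) (l : V) c K :
  f n @[n --> \oo] --> l -> (forall n, (K <= n)%N -> `|f n| <= c) -> `|l| <= c.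
Proof.
move=> fl fc; apply/ler_addgt0Pr => eps e0.
have /cvg_seqP/(_ _ e0)[L hL] := fl.
have := hL (maxn K L) (leq_maxr _ _); have := fc (maxn K L) (leq_maxl _ _).
have := ler_normD (l - f (maxn K L)) (f (maxn K L)); rewrite subrK; lra.
Qed.

End DoubleLimits.

Lemma lipschitz_continuous (R : realType) (X : normedModType R) (g : X -> R) K :
  (forall x y, `|g x - g y| <= K * `|x - y|) -> continuous (g : X -> R^o).
Proof.
move=> gK x; apply/cvgrPdist_le => eps e0; near=> y.
apply: le_trans (gK _ _) _; apply: (@le_trans _ _ ((`|K| + 1) * `|x - y|)).
  by rewrite ler_wpM2r// (le_trans (ler_norm K))// lerDl.
rewrite -ler_pdivlMl ?ltr_wpDl//; near: y.
by apply: cvgr_dist_le; [exact: cvg_id|rewrite mulr_gt0// invr_gt0 ltr_wpDl].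
Unshelve. all: by end_near. Qed.

Lemma small_eq0 (R : realType) (a K : R) : (forall eps, 0 < eps -> `|a| <= K * eps) -> a = 0.
Proof.
move=> aK; apply/eqP; rewrite -normr_le0; apply/ler_addgt0Pr => eps e0; rewrite add0r.
have K0 : 0 < `|K| + 1 by rewrite ltr_wpDl.
apply: le_trans (aK _ (divr_gt0 e0 K0)) _.
rewrite mulrCA ger_pMr// ler_pdivrMr// mul1r.
by rewrite (le_trans (ler_norm K))// lerDl.
Qed.

Section UltraLimits.
Variables (R : realType) (U : set_system nat).
Hypothesis UU : UltraFilter U.

Lemma ultra_bounded_cvg (f : nat -> R) (M : R) : (forall n, `|f n| <= M) ->
  exists r : R, forall eps, 0 < eps -> \forall n \near U, `|f n - r| <= eps.
Proof.
move=> fM; have PU : ProperFilter U by exact: ultra_proper.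
have [|r [_ rc]] := @segment_compact R (- M) M (f @ U) (fmap_proper_filter f PU).
  by apply: (filterE (F := U)) => n /=; rewrite in_itv /= -ler_norml fM.
exists r => eps e0; have [//|nU] := in_ultra_setVsetC [set n | `|f n - r| <= eps] UU.
have [x [/= [n nE fn]]] :
  [set f n | n in ~` [set n | `|f n - r| <= eps]] `&` ball r eps !=set0.
  apply: rc; last exact: nbhsx_ballx.
  by apply: (filterS (F := U) _ nU) => n nE; exists n.
by rewrite -ball_normE /= -fn distrC => /ltW h; case: (nE h).
Qed.

End UltraLimits.

Section DualBounds.
Variables (R : realType) (X : normedModType R).

Lemma dual_norm_ub (f : cdual X) x : `|f x| <= `|f| * `|x|.
Proof.
have ub : has_ubound [set `|f x| | x in [set x : X | `|x| <= 1]].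
  have /linear_boundedP[M [_ Mb]] : bounded_near f (nbhs (0 : X)).
    by apply: continuous_linear_bounded; exact: cdual_continuous.
  exists (`|M| + 1) => _ [y /= y1 <-].
  apply: (le_trans (Mb (`|M| + 1) _ y)).
    by rewrite (le_lt_trans (ler_norm M))// ltrDl.
  by rewrite ler_piMr// addr_ge0.
have [->|x0] := eqVneq x 0; first by rewrite linear0 !normr0 mulr0.
rewrite -ler_pdivrMr ?normr_gt0//.
have : `|f (`|x|^-1 *: x)| <= `|f|.
  change (`|f (`|x|^-1 *: x)| <= dual_norm f).
  apply: ub_le_sup => //; exists (`|x|^-1 *: x) => //=.
  by rewrite normrZ normfV normr_id mulVf// normr_eq0.
by rewrite linearZ normrM normfV normr_id mulrC.
Qed.

Lemma dual_norm_le (f : cdual X) c : (forall x, `|x| <= 1 -> `|f x| <= c) -> `|f| <= c.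
Proof.
move=> fc; change (dual_norm f <= c).
apply: ge_sup; first by exists `|f 0|, 0 => //=; rewrite normr0.
by move=> _ [x /= x1 <-]; exact: fc.
Qed.

End DualBounds.

(** * 2-rotund norms: reflexivity and convergence *)

Lemma pow2_small (R : realType) (B eps : R) : 0 < eps ->
  exists K, forall l, (K <= l)%N -> B / 2 ^+ l <= eps.
Proof.
move=> e0; exists (Num.bound `|B / eps|) => l Kl.
rewrite ler_pdivrMr ?exprn_gt0// mulrC -ler_pdivrMr//.
apply: (le_trans (ler_norm _)); apply: ltW.
apply: (lt_le_trans (archi_boundP (normr_ge0 _))).
by rewrite -natrX ler_nat (leq_trans Kl)// ltnW// ltn_expl.
Qed.

Section RotundReflexive.
Variables (R : realType) (X : normedModType R) (N : X -> R).
Hypotheses (ND : forall x y, N (x + y) <= N x + N y)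
  (NZ : forall a x, N (a *: x) = `|a| * N x).
Variables (c C : R).
Hypotheses (c0 : 0 < c) (cN : forall x, c * `|x| <= N x)
  (NC : forall x, N x <= C * `|x|).
Hypothesis rotN : two_rotund N.

Let N_ge0 x : 0 <= N x.
Proof. by apply: le_trans (cN x); rewrite mulr_ge0// ltW. Qed.

Let N0 : N 0 = 0.
Proof. by rewrite -(scale0r (0 : X)) NZ normr0 mul0r. Qed.

Let N_eq0 x : N x = 0 -> x = 0.
Proof.
move=> x0; apply/eqP; rewrite -normr_le0; have := cN x; rewrite x0.
by rewrite pmulr_rle0.
Qed.

Let NB x y : N (x - y) = N (y - x).
Proof. by rewrite -[RHS]mul1r -normrN1 -NZ scaleN1r opprB. Qed.

Let unit_dual (f : cdual X) := forall x, f x <= N x.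

Section Functional.
Variables (psi : cdual X -> R) (f_ : nat -> cdual X).
Hypotheses (psiD : forall f g, psi (f + g) = psi f + psi g)
  (psiZ : forall a f, psi (a *: f) = a * psi f)
  (psi1 : forall f, unit_dual f -> psi f <= 1)
  (f_1 : forall l, unit_dual (f_ l)) (f_psi : forall l, 1 - 8 ^- l <= psi (f_ l)).

(** Otherwise [h], divided by a number slightly below [psi h], would be a unit
    functional at which [psi] exceeds one. *)
Lemma functional_attained h eta : 0 < eta -> exists2 x, N x <= 1 & psi h - eta < h x.
Proof.
move=> e0; apply: contrapT => nh.
have hx x : N x <= 1 -> h x <= psi h - eta.
  by move=> x1; rewrite leNgt; apply/negP => hx; apply: nh; exists x.
have r0 : 0 <= psi h - eta by rewrite -(linear0 h) hx// N0.
pose r := psi h - eta + eta / 2; have r_gt0 : 0 < r by rewrite ltr_wpDl// divr_gt0.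
have : psi (r^-1 *: h) <= 1.
  apply: psi1 => x; change (r^-1 * h x <= N x); rewrite ler_pdivrMl//.
  have [x0|x0] := eqVneq (N x) 0; first by rewrite (N_eq0 x0) linear0 N0 mulr0.
  have nx : 0 < N x by rewrite lt_neqAle eq_sym x0 N_ge0.
  rewrite -ler_pdivrMr// mulrC; have : h ((N x)^-1 *: x) <= psi h - eta.
    by apply: hx; rewrite NZ ger0_norm ?invr_ge0// mulVf.
  by rewrite linearZ /= /r => /le_trans; apply; rewrite lerDl divr_ge0// ltW.
rewrite psiZ ler_pdivrMl// mulr1 /r; lra.
Qed.

(** The explicit rate is what makes the condition pass to limits, and comparable
    between two points. *)
Definition norming y :=
  N y <= 1 /\ exists B k, forall l, (k <= l)%N -> 1 - B / 2 ^+ l <= f_ l y.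

(** The sequence that alternates between the two points has all its pairwise
    sums of norm two, so it converges by rotundity. *)
Lemma norming_unique y z : norming y -> norming z -> y = z.
Proof.
move=> [y1 [B [k hB]]] [z1 [B' [k' hB']]].
pose u n := if odd n then y else z.
pose M := maxn k k'; pose D := Num.max B B'.
have ul n l : (M <= l)%N -> 1 - D / 2 ^+ l <= f_ l (u n).
  rewrite geq_max => /andP[kl kl']; rewrite /u; case: ifP => _.
    apply: le_trans (hB l kl); rewrite lerD2l lerN2 ler_pM2r ?invr_gt0 ?exprn_gt0//.
    by rewrite le_max lexx.
  apply: le_trans (hB' l kl'); rewrite lerD2l lerN2 ler_pM2r ?invr_gt0 ?exprn_gt0//.
  by rewrite le_max lexx orbT.
have u1 n : N (u n) <= 1 by rewrite /u; case: ifP.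
have fuN l m n : f_ l (u m) + f_ l (u n) <= N (u m + u n).
  by rewrite -linearD; exact: f_1.
have [|w /cvg_seqP uw] := rotN u1.
  apply/(cvg_pairP (fun m n => N (u m + u n))) => eps e0; exists 0%N => m n _ _.
  have e20 : 0 < eps / 2 by rewrite divr_gt0.
  have [K hK] := pow2_small D e20.
  have h1 := ND (u m) (u n); have h2 := u1 m; have h3 := u1 n.
  have h4 := hK _ (leq_maxr M K); have h5 := fuN (maxn M K) m n.
  have h6 := ul m _ (leq_maxl M K); have h7 := ul n _ (leq_maxl M K).
  by rewrite ger0_norm; lra.
have uwE n : u n = u n.+2 by rewrite /u /= negbK.
have uw0 n : u n = w.
  apply/eqP; rewrite -subr_eq0; apply/eqP/N_eq0/eqP; rewrite eq_le N_ge0 andbT.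
  apply/ler_addgt0Pr => eps /uw[K hK]; rewrite add0r.
  have -> : u n = u (n + K.*2)%N by rewrite /u oddD odd_double addbF.
  have := hK (n + K.*2)%N; rewrite sub0r normrN ger0_norm//; apply.
  by rewrite -addnn addnA leq_addl.
by rewrite (_ : y = u 1%N) // (_ : z = u 0%N) // !uw0.
Qed.

(** Points nearly normed by a common functional have sums of norm nearly two, so
    rotundity provides the limit. *)
Lemma norming_limit (y_ : nat -> X) B k : (forall n, N (y_ n) <= 1) ->
  (forall n l, (k <= l < n)%N -> 1 - B / 2 ^+ l <= f_ l (y_ n)) ->
  exists2 y, norming y & N (y_ n - y) @[n --> \oo] --> (0 : R).
Proof.
move=> y1 hB; have [|y ycvg] := rotN y1.
  apply/(cvg_pairP (fun m n => N (y_ m + y_ n))) => eps e0.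
  have e20 : 0 < eps / 2 by rewrite divr_gt0.
  have [K hK] := pow2_small B e20.
  exists (maxn k K).+1 => m n Km Kn; set l := maxn k K in Km Kn.
  have h1 := ND (y_ m) (y_ n); have h2 := y1 m; have h3 := y1 n.
  have h4 := hK _ (leq_maxr k K); have h5 := f_1 l (y_ m + y_ n).
  rewrite linearD in h5.
  have h6 : 1 - B / 2 ^+ l <= f_ l (y_ m) by apply: hB; rewrite leq_maxl.
  have h7 : 1 - B / 2 ^+ l <= f_ l (y_ n) by apply: hB; rewrite leq_maxl.
  by rewrite ger0_norm; lra.
exists y => //; move/cvg_seqP : ycvg => ycvg; split.
  apply/ler_addgt0Pr => eps /ycvg[K /(_ K (leqnn _))].
  rewrite sub0r normrN ger0_norm// => hK.
  have := ND (y_ K) (y - y_ K); rewrite addrC subrK NB; have := y1 K; lra.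
exists B, k => l kl; apply/ler_addgt0Pr => eps /ycvg[K].
move=> /(_ (maxn K l.+1) (leq_maxl _ _)); set n := maxn K l.+1.
rewrite sub0r normrN ger0_norm// => hK.
have := hB n l; rewrite kl leq_maxr => /(_ isT).
have := f_1 l (y_ n - y); rewrite linearB; lra.
Qed.

(** The weights [2 ^+ l] make a loss at [f_ l] expensive, while [psi (f_ l)] is
    so close to one that the total loss [\sum 2 ^+ l * 8 ^- l] from index [k] on
    stays below any prescribed bound. *)
Lemma attained_norming g eps : 0 < eps -> exists2 y, norming y & psi g - eps <= g y.
Proof.
move=> e0; have [k hk] := pow2_small 3 e0.
pose h n := \sum_(k <= l < n) 2 ^+ l *: f_ l + g.
have psiE n : psi (h n) = \sum_(k <= l < n) 2 ^+ l * psi (f_ l) + psi g.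
  rewrite psiD; congr (_ + _); rewrite (big_morph psi psiD (id1 := 0)).
    by apply: eq_bigr => l _; rewrite psiZ.
  by rewrite -(scale0r (0 : cdual X)) psiZ mul0r.
have hE n x : h n x = \sum_(k <= l < n) 2 ^+ l * f_ l x + g x.
  change ((\sum_(k <= l < n) 2 ^+ l *: f_ l : cdual X) x + g x =
    \sum_(k <= l < n) 2 ^+ l * f_ l x + g x); congr (_ + _).
  by rewrite (big_morph (fun f : cdual X => f x) (id1 := 0) (op1 := +%R)).
have geo n : \sum_(k <= l < n) 2 ^+ l * 8 ^- l <= 2 / 2 ^+ k :> R.
  have E l : 2 ^+ l * 8 ^- l = 4 ^- l :> R.
    have -> : 8 = 2 * 4 :> R by ring.
    by rewrite exprMn invfM mulrA mulfV ?mul1r// gt_eqF// exprn_gt0.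
  under eq_bigr do rewrite E.
  have [nk|kn] := leqP n k; first by rewrite big_geq// divr_ge0// exprn_ge0.
  apply: (@le_trans _ _ (2 / 4 ^+ k)); last first.
    rewrite ler_pM2l// lef_pV2 ?posrE ?exprn_gt0//.
    by rewrite lerXn2r// ?nnegrE//; lra.
  (* The remainder of the geometric series makes the bound inductive. *)
  apply: (@le_trans _ _ (2 / 4 ^+ k - 4 / 3 * 4 ^- n)); last first.
    by rewrite gerBl mulr_ge0// invr_ge0 exprn_ge0.
  elim: n kn => // n IHn; rewrite ltnS leq_eqVlt => /orP[/eqP<-|kn].
    rewrite big_nat1 exprS invfM; have : 0 < 4 ^- k :> R by rewrite invr_gt0 exprn_gt0.
    lra.
  rewrite big_nat_recr ?(ltnW kn)//=; have := IHn kn; rewrite (exprS _ n) invfM.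
  have : 0 < 4 ^- n :> R by rewrite invr_gt0 exprn_gt0.
  lra.
have k20 : 0 < 2 ^- k :> R by rewrite invr_gt0 exprn_gt0.
have /choice[y_ hy] n : exists y, N y <= 1 /\ psi (h n) - 2 ^- k < h n y.
  by have [y] := functional_attained (h n) k20; exists y.
have y1 n : N (y_ n) <= 1 by case: (hy n).
have fy1 n l : f_ l (y_ n) <= 1 by apply: le_trans (f_1 _ _) (y1 n).
have key n : \sum_(k <= l < n) 2 ^+ l * (1 - f_ l (y_ n)) <=
    g (y_ n) - psi g + 3 / 2 ^+ k.
  have [_] := hy n; rewrite psiE hE => hn.
  have : \sum_(k <= l < n) 2 ^+ l * (1 - f_ l (y_ n)) <=
     \sum_(k <= l < n) 2 ^+ l * psi (f_ l) - \sum_(k <= l < n) 2 ^+ l * f_ l (y_ n)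
     + \sum_(k <= l < n) 2 ^+ l * 8 ^- l.
    rewrite -sumrB -big_split /=; apply: ler_sum => l _.
    rewrite -mulrBr -mulrDr ler_pM2l ?exprn_gt0//.
    by have := f_psi l; lra.
  have := geo n; lra.
have pos n l : 0 <= 2 ^+ l * (1 - f_ l (y_ n)).
  by rewrite mulr_ge0 ?exprn_ge0// subr_ge0.
have gy n : psi g - eps <= g (y_ n).
  have := key n; have : 0 <= \sum_(k <= l < n) 2 ^+ l * (1 - f_ l (y_ n)) by apply: sumr_ge0.
  by have := hk k (leqnn _); lra.
pose B := `|g| / c - psi g + 3 / 2 ^+ k.
have [|y ny /cvg_seqP ycvg] := @norming_limit y_ B k y1.
  move=> n l /andP[kl ln]; rewrite lerBlDr -lerBlDl.
  rewrite ler_pdivlMr ?exprn_gt0// mulrC.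
  apply: (@le_trans _ _ (g (y_ n) - psi g + 3 / 2 ^+ k)).
    apply: le_trans (key n); rewrite (@big_cat_nat _ _ _ l)//=; last exact: ltnW.
    rewrite (big_ltn ln) addrCA lerDl addr_ge0//; exact: sumr_ge0.
  rewrite /B lerD2r lerD2r (le_trans (ler_norm _))// (le_trans (dual_norm_ub _ _))//.
  rewrite ler_wpM2l// -[leRHS]mul1r ler_pdivlMr// mulrC.
  by apply: le_trans (cN _) (y1 n).
exists y => //; apply/ler_addgt0Pr => d d0.
have gc0 : 0 < c / (`|g| + 1) by rewrite divr_gt0// ltr_wpDl.
have [K /(_ K (leqnn _))] := ycvg _ (mulr_gt0 d0 gc0).
rewrite sub0r normrN ger0_norm// => hK.
have h1 : c * `|y_ K - y| <= d * (c / (`|g| + 1)) by apply: le_trans (cN _) hK.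
have h2 : (`|g| + 1) * `|y_ K - y| <= d.
  move: h1; rewrite mulrA ler_pdivlMr ?ltr_wpDl// => h1.
  rewrite -(ler_pM2l c0); lra.
have h3 : `|g (y_ K - y)| <= d.
  apply: le_trans (dual_norm_ub _ _) (le_trans _ h2).
  by rewrite ler_wpM2r// lerDl.
rewrite linearB in h3; have := le_trans (ler_norm _) h3; have := gy K; lra.
Qed.

End Functional.

(** The points nearly normed by functionals at which [phi] is nearly attained
    converge to a single point, which dominates [phi] at every functional and at
    its opposite. *)
Theorem two_rotund_reflexive : reflexive_space X.
Proof.
move=> phi.
have unitP g : exists k, 0 < k /\ unit_dual (k *: g) /\ unit_dual (k *: - g).
  pose k := c / (`|g| + 1); have k0 : 0 < k by rewrite divr_gt0// ltr_wpDl.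
  have gk x : k * `|g x| <= N x.
    apply: le_trans (cN x); rewrite /k mulrAC ler_pdivrMr ?ltr_wpDl// -mulrA ler_pM2l//.
    apply: (le_trans (dual_norm_ub g x)); rewrite mulrC ler_wpM2l//.
    by rewrite lerDl.
  exists k; split=> //; split => x.
    change (k * g x <= N x); apply: le_trans (gk x); rewrite ler_pM2l//.
    exact: ler_norm.
  change (k * - g x <= N x); apply: le_trans (gk x); rewrite ler_pM2l// -normrN.
  exact: ler_norm.
pose D := [set phi f | f in unit_dual].
have ubD : has_ubound D.
  exists (`|phi| * `|C|) => _ [f f1 <-]; apply: (le_trans (ler_norm _)).
  apply: (le_trans (dual_norm_ub _ _)); rewrite ler_wpM2l//.
  apply: dual_norm_le => x x1; have CN : N x <= `|C|.
    apply: (le_trans (NC x)); apply: (le_trans (ler_norm _)).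
    by rewrite normrM normr_id ler_piMr.
  rewrite ler_norml lerNl; apply/andP; split; last exact: le_trans (f1 x) CN.
  rewrite -linearN; apply: le_trans (f1 _) _.
  by rewrite -scaleN1r NZ normrN1 mul1r.
have D0 : D 0.
  by exists 0; [move=> x; exact: N_ge0|rewrite linear0].
pose s := sup D; have s0 : 0 <= s by exact: ub_le_sup.
have sD f : unit_dual f -> phi f <= s by move=> f1; apply: ub_le_sup => //; exists f.
move: s0; rewrite le_eqVlt => /orP[/eqP s0|s0].
  exists 0 => g; rewrite linear0; have [k [k0 [/sD + /sD]]] := unitP g.
  rewrite -s0 !linearZ /= linearN.
  change (k * phi g <= 0 -> k * - phi g <= 0 -> phi g = 0).
  rewrite !pmulr_rle0// oppr_le0 => h1 h2; apply/eqP.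
  by rewrite eq_le h1 h2.
pose psi f : R := s^-1 * phi f.
have psiD f g : psi (f + g) = psi f + psi g by rewrite /psi linearD mulrDr.
have psiZ a f : psi (a *: f) = a * psi f.
  by rewrite /psi linearZ /= mulrCA.
have psi1 f : unit_dual f -> psi f <= 1.
  by move=> /sD fs; rewrite /psi ler_pdivrMl// mulr1.
have /choice[f_ hf] l : exists f, unit_dual f /\ 1 - 8 ^- l <= psi f.
  have e0 : 0 < s * 8 ^- l by rewrite mulr_gt0// invr_gt0 exprn_gt0.
  have [|_ [f f1 <-] hs] := sup_adherent e0 (E := D); first by split=> //; exists 0.
  by exists f; split=> //; rewrite /psi ler_pdivlMl// mulrBr mulr1 ltW.
have f_1 l : unit_dual (f_ l) by case: (hf l).
have f_psi l : 1 - 8 ^- l <= psi (f_ l) by case: (hf l).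
have [x nx _] := attained_norming psiD psiZ psi1 f_1 f_psi 0 ltr01.
have psix g : psi g <= g x.
  apply/ler_addgt0Pr => eps e0.
  have [y ny] := attained_norming psiD psiZ psi1 f_1 f_psi g e0.
  by rewrite (norming_unique f_1 ny nx) lerBlDr.
exists (s *: x) => g; have psixE : psi g = g x.
  apply/eqP; rewrite eq_le psix /=; have := psix (- g).
  rewrite -scaleN1r psiZ mulN1r scaleN1r; change (- psi g <= - g x -> g x <= psi g).
  by rewrite lerN2.
rewrite linearZ /= -psixE /psi; change (phi g = s * (s^-1 * phi g)).
by rewrite mulrA mulfV ?mul1r// gt_eqF.
Qed.

End RotundReflexive.

(** The defect controls the differences of the norms, so these converge; after
    normalization the sums of pairs have norm tending to two. *)
Lemma two_rotund_parallelogram (R : realType) (Y : completeNormedModType R)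
    (u : nat -> Y) : two_rotund (fun y : Y => `|y|) ->
  (forall eps, 0 < eps -> exists K : nat, forall m n, (K <= m)%N -> (K <= n)%N ->
    2 * `|u m| ^+ 2 + 2 * `|u n| ^+ 2 - `|u m + u n| ^+ 2 <= eps) ->
  cvgn u.
Proof.
move=> rot par.
have dist_le m n : (`|u m| - `|u n|) ^+ 2 <=
    2 * `|u m| ^+ 2 + 2 * `|u n| ^+ 2 - `|u m + u n| ^+ 2.
  have h : `|u m + u n| ^+ 2 <= (`|u m| + `|u n|) ^+ 2.
    by rewrite ler_sqr ?nnegrE ?addr_ge0// ler_normD.
  nra.
have /cvg_ex[/= r /cvg_seqP rc] : cvgn (fun n => `|u n|).
  apply: cauchy_seq_cvg => eps e0; have [K hK] := par _ (exprn_gt0 2 e0).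
  exists K => m n Km Kn; rewrite -ler_sqr ?nnegrE ?(ltW e0)//.
  by rewrite real_normK ?num_real// (le_trans (dist_le m n))// hK.
have r0 : 0 <= r.
  apply/ler_addgt0Pr => eps /rc[K /(_ K (leqnn _))].
  by rewrite ler_norml => /andP[h _]; have := normr_ge0 (u K); lra.
move: r0; rewrite le_eqVlt => /orP[/eqP r0|r0].
  apply/cvg_ex; exists 0; apply/cvg_seqP => eps /rc[K hK]; exists K => n /hK.
  by rewrite -r0 !sub0r !normrN normr_id.
pose w n := `|u n|^-1 *: u n.
have w1 n : `|w n| <= 1.
  rewrite normrZ normfV normr_id; have [->|u0] := eqVneq `|u n| 0; first by rewrite mulr0.
  by rewrite mulVf.
have [|z /cvg_seqP wz] := rot w w1.
  apply/(cvg_pairP (fun m n => `|w m + w n|)) => eps e0.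
  have [d [d0 dr de]] : exists d, [/\ 0 < d, d <= r / 4 & d <= r * eps / 6].
    exists (Num.min (r / 4) (r * eps / 6)).
    by rewrite lt_min !ge_min !lexx orbT !divr_gt0// mulr_gt0.
  have [K1 h1] := rc _ d0; have [K2 h2] := par _ (mulr_gt0 r0 d0).
  exists (maxn K1 K2) => m n; rewrite !geq_max => /andP[m1 m2] /andP[n1 n2].
  have wmn : `|w m + w n| <= 2.
    by apply: le_trans (ler_normD _ _) _; rewrite -[2]/(1 + 1) lerD.
  rewrite ger0_norm ?subr_ge0// lerBlDr -lerBlDl.
  rewrite -(ler_pM2l r0).
  have um := h1 m m1; have un := h1 n n1; have umn := h2 m n m2 n2.
  have big : 2 * r - 4 * d <= `|u m + u n|.
    rewrite leNgt; apply/negP => lt.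
    have : `|u m + u n| ^+ 2 <= (2 * r - 4 * d) ^+ 2.
      by rewrite ler_sqr ?nnegrE ?(ltW lt)//; lra.
    move: um un; rewrite !ler_norml => /andP[_ um] /andP[_ un].
    have um' : (r - d) ^+ 2 <= `|u m| ^+ 2 by rewrite ler_sqr ?nnegrE//; lra.
    have un' : (r - d) ^+ 2 <= `|u n| ^+ 2 by rewrite ler_sqr ?nnegrE//; lra.
    nra.
  have uE k : u k = `|u k| *: w k.
    rewrite /w scalerA; have [u0|u0] := eqVneq `|u k| 0.
      by rewrite u0 mul0r scale0r; apply/eqP; rewrite -normr_eq0 u0.
    by rewrite mulfV// scale1r.
  have close k : `|r - `|u k| | <= d -> `|u k - r *: w k| <= d.
    move=> uk; rewrite {1}uE -scalerBl normrZ distrC.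
    by apply: le_trans uk; rewrite ler_piMr.
  have := ler_normD (u m - r *: w m + (u n - r *: w n)) (r *: (w m + w n)).
  rewrite scalerDr addrACA !subrK -scalerDr normrZ (gtr0_norm r0).
  have := ler_normD (u m - r *: w m) (u n - r *: w n).
  have := close m um; have := close n un; lra.
apply/cvg_ex; exists (r *: z).
have -> : u = (fun n => `|u n| *: w n).
  apply/funext => k; rewrite /w scalerA; have [u0|u0] := eqVneq `|u k| 0.
    by rewrite u0 mul0r scale0r; apply/eqP; rewrite -normr_eq0 u0.
  by rewrite mulfV// scale1r.
apply: cvgZ; first by apply/cvg_seqP.
apply/cvg_seqP => eps /wz[K hK]; exists K => n /hK.
by rewrite sub0r normrN normr_id distrC.
Qed.

(** * Unconditional bases *)

Section UnconditionalNorm.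
Variables (R : realType) (Y : completeNormedModType R) (e : nat -> Y).
Hypothesis unc : one_unconditional e.
Implicit Types a b : nat -> R.

Definition psum a K : Y := \sum_(0 <= j < K) a j *: e j.

Lemma expansionE a : expansion e a = psum a.
Proof. by apply/funext => n; rewrite /expansion seriesEnat. Qed.

Lemma psum_cvg a K : (forall j, (K <= j)%N -> a j = 0) ->
  expansion e a @ \oo --> psum a K.
Proof.
move=> aK; rewrite expansionE; apply: cvg_near_cst; exists K => // n /= Kn.
rewrite /psum (@big_cat_nat _ _ _ K 0 n)//= [X in _ + X]big_nat_cond.
by rewrite [X in _ + X]big1 ?addr0// => j /andP[/andP[Kj _] _]; rewrite aK// scale0r.
Qed.

Lemma psum_flip a s K : `|psum (fun j => (-1) ^+ (s j : bool) * a j) K| <= `|psum a K|.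
Proof.
pose t j := if (j < K)%N then a j else 0.
have -> : psum a K = psum t K.
  by apply: eq_big_nat => j /andP[_ jK]; rewrite /t jK.
have -> : psum (fun j => (-1) ^+ s j * a j) K = psum (fun j => (-1) ^+ s j * t j) K.
  by apply: eq_big_nat => j /andP[_ jK]; rewrite /t jK.
have t0 j : (K <= j)%N -> t j = 0 by rewrite leqNgt /t => /negbTE ->.
apply: (unc (a := t) (s := s)); apply: psum_cvg => // j Kj.
by rewrite t0// mulr0.
Qed.

(** Shrinking one coefficient is averaging with a change of sign. *)
Lemma psum_shrink a k l K : `|l| <= 1 ->
  `|psum (fun j => if j == k then l * a j else a j) K| <= `|psum a K|.
Proof.
rewrite ler_norml => /andP[l1 l2].
pose s j := j == k.
have -> : psum (fun j => if j == k then l * a j else a j) K =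
    ((1 + l) / 2) *: psum a K + ((1 - l) / 2) *: psum (fun j => (-1) ^+ s j * a j) K.
  rewrite /psum !scaler_sumr -big_split /=; apply: eq_bigr => j _.
  rewrite !scalerA -scalerDl; congr (_ *: _); rewrite /s.
  by case: eqP => _; rewrite ?expr1 ?expr0; field.
have h := psum_flip a s K.
have p1 : 0 <= (1 + l) / 2 by lra.
have p2 : 0 <= (1 - l) / 2 by lra.
apply: le_trans (ler_normD _ _) _.
rewrite (normrZ ((1 + l) / 2)) (normrZ ((1 - l) / 2)) (ger0_norm p1) (ger0_norm p2).
have := ler_wpM2l p2 h; lra.
Qed.

(** The coefficients are replaced one at a time; [h k] is the stage at which
    those below [k] have been replaced. *)
Lemma psum_mono a b K : (forall j, `|a j| <= `|b j|) -> `|psum a K| <= `|psum b K|.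
Proof.
move=> ab; pose h k j := if (j < k)%N then a j else b j.
have -> : psum a K = psum (h K) K.
  by apply: eq_big_nat => j /andP[_ jK]; rewrite /h jK.
have -> : psum b K = psum (h 0%N) K by [].
elim: {1}K => [//|k IHk]; apply: le_trans IHk.
have [l [l1 lE]] : exists l, `|l| <= 1 /\ a k = l * b k.
  have [b0|b0] := eqVneq (b k) 0.
    exists 0; rewrite normr0 ler01 mul0r; split=> //; apply/eqP.
    by rewrite -normr_le0 (le_trans (ab k))// b0 normr0.
  exists (a k / b k); rewrite divfK//; split=> //.
  by rewrite normrM normfV ler_pdivrMr ?normr_gt0// mul1r.
rewrite (_ : psum (h k.+1) K = psum (fun j => if j == k then l * h k j else h k j) K).
  exact: psum_shrink.
apply: eq_bigr => j _; congr (_ *: _); rewrite /h ltnS leq_eqVlt.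
by case: eqP => [->|_] //=; rewrite ltnn.
Qed.

Definition tail a J j : R := if (J <= j)%N then a j else 0.

Lemma psum_tail a J K : psum (tail a J) K = \sum_(J <= j < K) a j *: e j.
Proof.
rewrite /psum; have [JK|KJ] := leqP J K.
  rewrite (@big_cat_nat _ _ _ J)//= [X in X + _]big_nat_cond big1 ?add0r.
    by apply: eq_big_nat => j /andP[Jj _]; rewrite /tail Jj.
  by move=> j /andP[/andP[_ jJ] _]; rewrite /tail leqNgt jJ scale0r.
rewrite [RHS]big_geq 1?ltnW// big_nat_cond big1// => j /andP[/andP[_ jK] _].
by rewrite /tail leqNgt (ltn_trans jK)// scale0r.
Qed.

Lemma psum_le_lim b K y : expansion e b @ \oo --> y -> `|psum b K| <= `|y|.
Proof.
move=> /cvg_norm by_; rewrite leNgt; apply/negP => yK.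
have : \forall n \near \oo, `|expansion e b n| < `|psum b K|.
  by move: by_ => /cvgr_lt; apply.
move=> [N _ /(_ (maxn N K) (leq_maxl _ _))] /=; rewrite expansionE ltNge => /negP; apply.
pose t j := if (j < K)%N then b j else 0.
rewrite (_ : psum b K = psum t (maxn N K)).
  by apply: psum_mono => j; rewrite /t; case: ifP => // _; rewrite normr0.
rewrite /psum [RHS](@big_cat_nat _ _ _ K) ?leq_maxr//=.
rewrite [X in _ = _ + X]big_nat_cond [X in _ = _ + X]big1 ?addr0.
  by apply: eq_big_nat => j /andP[_ jK]; rewrite /t jK.
by move=> j /andP[/andP[Kj _] _]; rewrite /t ltnNge Kj scale0r.
Qed.

Lemma expansion_tail b : cvgn (expansion e b) -> forall eps, 0 < eps ->
  exists J, forall K, `|psum (tail b J) K| <= eps.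
Proof.
move=> bc eps e0; have /cvg_seqP/(_ _ (divr_gt0 e0 (ltr0n R 2)))[J hJ] := bc.
exists J => K; rewrite psum_tail; have [KJ|JK] := leqP K J.
  by rewrite big_geq// normr0 ltW.
have -> : \sum_(J <= j < K) b j *: e j = psum b K - psum b J.
  by rewrite /psum (@big_cat_nat _ _ _ J 0 K)// ?(ltnW JK)//= addrAC subrr add0r.
have := hJ K (ltnW JK); have := hJ J (leqnn _); rewrite expansionE.
set l := lim _ => h1 h2.
have -> : psum b K - psum b J = (l - psum b J) - (l - psum b K).
  by rewrite opprB [RHS]addrC addrA subrK.
by apply: le_trans (ler_normB _ _) _; rewrite (splitr eps) lerD.
Qed.

Lemma psumB a b K : psum (fun j => a j - b j) K = psum a K - psum b K.
Proof.
by rewrite /psum -sumrB; apply: eq_bigr => j _; rewrite scalerBl.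
Qed.

Lemma tails_cvg b : (forall eps, 0 < eps -> exists J, forall K,
  `|psum (tail b J) K| <= eps) -> cvgn (expansion e b).
Proof.
move=> bt; rewrite expansionE; apply: cauchy_seq_cvg => eps /bt[J hJ].
have h m n : (J <= m)%N -> (m <= n)%N -> `|psum b n - psum b m| <= eps.
  move=> Jm mn.
  have -> : psum b n - psum b m = psum (tail b m) n.
    by rewrite psum_tail /psum (@big_cat_nat _ _ _ m 0 n)//= addrAC subrr add0r.
  apply: le_trans (hJ n); apply: psum_mono => j; rewrite /tail.
  case: ifP => [mj|_]; last by rewrite normr0.
  by rewrite (leq_trans Jm mj).
exists J => m n Jm Jn; have [mn|/ltnW nm] := leqP m n; last exact: h.
by rewrite distrC; exact: h.
Qed.

Lemma psum_add_le a b d J K : (forall j, 0 <= a j <= b j + d j) ->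
  `|psum (tail a J) K| <= `|psum (tail b J) K| + `|psum (tail d J) K|.
Proof.
move=> abd; apply: (@le_trans _ _ `|psum (fun j => tail b J j + tail d J j) K|).
  apply: psum_mono => j; rewrite /tail; case: ifP => _; last by rewrite normr0.
  have /andP[a0 abj] := abd j.
  by rewrite !ger0_norm// (le_trans a0).
rewrite (_ : psum (fun j => _) K = psum (tail b J) K + psum (tail d J) K).
  exact: ler_normD.
by rewrite /psum -big_split; apply: eq_bigr => j _; rewrite scalerDl.
Qed.

(** One expansion far out has small tails, and the later ones differ from it by
    an expansion of small norm, whose tails have norm no larger. *)
Lemma uniform_tails (a : nat -> nat -> R) : (forall n, cvgn (expansion e (a n))) ->
  cvgn (fun n => limn (expansion e (a n))) -> forall eps, 0 < eps ->
  exists N J, forall n K, (N <= n)%N -> `|psum (tail (a n) J) K| <= eps.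
Proof.
move=> ac /cvg_ex[/= y /cvg_seqP yc] eps e0; have e2 : 0 < eps / 2 by rewrite divr_gt0.
have [N hN] := yc _ (divr_gt0 e2 (ltr0n R 2)).
have [J hJ] := expansion_tail (ac N) e2; exists N, J => n K Nn.
have -> : psum (tail (a n) J) K =
    psum (tail (a N) J) K - psum (tail (fun j => a N j - a n j) J) K.
  rewrite -psumB; apply: eq_bigr => j _; congr (_ *: _); rewrite /tail.
  by case: ifP => _; rewrite ?subrr// opprB addrC subrK.
apply: le_trans (ler_normB _ _) _; rewrite (splitr eps) lerD//.
have cNn : expansion e (fun j => a N j - a n j) @ \oo -->
    limn (expansion e (a N)) - limn (expansion e (a n)).
  rewrite expansionE (_ : psum _ = expansion e (a N) \- expansion e (a n)).
    exact: cvgB (ac N) (ac n).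
  by apply/funext => k; rewrite psumB !expansionE.
apply: (@le_trans _ _ `|psum (fun j => a N j - a n j) K|).
  by apply: psum_mono => j; rewrite /tail; case: ifP; rewrite ?normr0.
apply: le_trans (psum_le_lim K cNn) _; have h1 := hN N (leqnn _); have h2 := hN n Nn.
rewrite -(subrK y (limn (expansion e (a N)))) -addrA.
by apply: le_trans (ler_normD _ _) _; rewrite (splitr (eps / 2)) distrC lerD.
Qed.

End UnconditionalNorm.

(** * Square roots of sums of squares of seminorms *)

Section SquareSum.
Variables (R : realType) (X : normedModType R) (D : X -> R) (T_ : nat -> X -> R).
Variable eps : nat -> R.
Hypotheses (D_ge0 : forall x, 0 <= D x) (DD : forall x y, D (x + y) <= D x + D y)
  (DZ : forall a x, D (a *: x) = `|a| * D x).
Hypotheses (T_ge0 : forall j x, 0 <= T_ j x)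
  (TD : forall j x y, T_ j (x + y) <= T_ j x + T_ j y)
  (TZ : forall j a x, T_ j (a *: x) = `|a| * T_ j x).
Hypothesis eps_gt0 : forall j, 0 < eps j.

Definition sqsum x : nat -> R := series (fun j => eps j * T_ j x ^+ 2).

Hypothesis sqsum_cvg : forall x, cvgn (sqsum x).

Definition sqnorm x := Num.sqrt (`|x| ^+ 2 + D x ^+ 2 + limn (sqsum x)).

Lemma sqsum_nd x : nondecreasing_seq (sqsum x).
Proof.
apply/nondecreasing_seqP => n; rewrite /sqsum seriesSr lerDl mulr_ge0 ?sqr_ge0//.
exact: ltW.
Qed.

Lemma sqsum_le x n : sqsum x n <= limn (sqsum x).
Proof. by apply: nondecreasing_cvgn_le; [exact: sqsum_nd|exact: sqsum_cvg]. Qed.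

Lemma lim_sqsum_le x M : (forall n, sqsum x n <= M) -> limn (sqsum x) <= M.
Proof. by move=> h; apply: limr_le; [exact: sqsum_cvg|exact: nearW]. Qed.

Lemma lim_sqsum_ge0 x : 0 <= limn (sqsum x).
Proof. by apply: le_trans (sqsum_le x 0%N); rewrite /sqsum /series /= big_geq. Qed.

Lemma sqr_sqnorm x : sqnorm x ^+ 2 = `|x| ^+ 2 + D x ^+ 2 + limn (sqsum x).
Proof. by rewrite sqr_sqrtr// !addr_ge0 ?sqr_ge0 ?lim_sqsum_ge0. Qed.

Lemma sqnorm_ge0 x : 0 <= sqnorm x. Proof. exact: sqrtr_ge0. Qed.

Lemma lim_sqsumZ a x : limn (sqsum (a *: x)) = a ^+ 2 * limn (sqsum x).
Proof.
apply: cvg_lim => //.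
rewrite (_ : sqsum (a *: x) = fun n => a ^+ 2 * sqsum x n).
  by apply: cvgM; [exact: cvg_cst|exact: sqsum_cvg].
apply/funext => n; rewrite /sqsum /series /= mulr_sumr; apply: eq_bigr => j _.
by rewrite TZ exprMn real_normK ?num_real// mulrCA.
Qed.

Lemma sqnormZ a x : sqnorm (a *: x) = `|a| * sqnorm x.
Proof.
have -> : `|a| * sqnorm x = Num.sqrt (a ^+ 2) * sqnorm x by rewrite sqrtr_sqr.
rewrite /sqnorm -sqrtrM ?sqr_ge0//; congr Num.sqrt.
by rewrite lim_sqsumZ normrZ DZ !exprMn !real_normK ?num_real// !mulrDr.
Qed.

(** The terms of the sum all satisfy a weighted form of the parallelogram
    inequality, and optimizing the weight gives the triangle inequality. *)
Let weighted (a b s r : R) : 0 < r -> r < 1 -> 0 <= s -> s <= a + b ->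
  s ^+ 2 <= a ^+ 2 / r + b ^+ 2 / (1 - r).
Proof.
move=> r0 r1 s0 sab; have r1' : 0 < 1 - r by rewrite subr_gt0.
apply: (@le_trans _ _ ((a + b) ^+ 2)); first by rewrite ler_sqr ?nnegrE// (le_trans s0).
rewrite -subr_ge0.
have -> : a ^+ 2 / r + b ^+ 2 / (1 - r) - (a + b) ^+ 2 =
    ((1 - r) * a - r * b) ^+ 2 / (r * (1 - r)).
  by field; rewrite !gt_eqF.
by rewrite divr_ge0 ?sqr_ge0// mulr_ge0// ltW.
Qed.

Lemma sqnorm_weighted r x y : 0 < r -> r < 1 ->
  sqnorm (x + y) ^+ 2 <= sqnorm x ^+ 2 / r + sqnorm y ^+ 2 / (1 - r).
Proof.
move=> r0 r1; have r1' : 0 < 1 - r by rewrite subr_gt0.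
rewrite !sqr_sqnorm.
have h1 := weighted r0 r1 (normr_ge0 (x + y)) (ler_normD x y).
have h2 := weighted r0 r1 (D_ge0 (x + y)) (DD x y).
have h3 : limn (sqsum (x + y)) <= limn (sqsum x) / r + limn (sqsum y) / (1 - r).
  apply: lim_sqsum_le => n.
  apply: (@le_trans _ _ (sqsum x n / r + sqsum y n / (1 - r))); last first.
    by rewrite lerD// ler_pM2r ?invr_gt0// sqsum_le.
  rewrite /sqsum /series /= !mulr_suml -big_split /=; apply: ler_sum => j _.
  have := ler_wpM2l (ltW (eps_gt0 j)) (weighted r0 r1 (T_ge0 j _) (TD j x y)).
  by lra.
rewrite !mulrDl; lra.
Qed.

Lemma sqnorm_norm x : `|x| <= sqnorm x.
Proof.
rewrite -ler_sqr ?nnegrE ?sqnorm_ge0// sqr_sqnorm.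
by have := sqr_ge0 (D x); have := lim_sqsum_ge0 x; lra.
Qed.

Lemma sqnormD x y : sqnorm (x + y) <= sqnorm x + sqnorm y.
Proof.
have [x0|x0] := eqVneq (sqnorm x) 0.
  have -> : x = 0.
    by apply/eqP; rewrite -normr_le0; apply: le_trans (sqnorm_norm x) _; rewrite x0.
  by rewrite add0r lerDr sqnorm_ge0.
have [y0|y0] := eqVneq (sqnorm y) 0.
  have -> : y = 0.
    by apply/eqP; rewrite -normr_le0; apply: le_trans (sqnorm_norm y) _; rewrite y0.
  by rewrite addr0 lerDl sqnorm_ge0.
have nx : 0 < sqnorm x by rewrite lt_neqAle eq_sym x0 sqnorm_ge0.
have ny : 0 < sqnorm y by rewrite lt_neqAle eq_sym y0 sqnorm_ge0.
have nxy : 0 < sqnorm x + sqnorm y by rewrite addr_gt0.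
rewrite -ler_sqr ?nnegrE ?sqnorm_ge0 ?(ltW nxy)//.
have r0 : 0 < sqnorm x / (sqnorm x + sqnorm y) by rewrite divr_gt0.
have r1 : sqnorm x / (sqnorm x + sqnorm y) < 1.
  by rewrite ltr_pdivrMr// mul1r ltrDl.
apply: le_trans (sqnorm_weighted x y r0 r1) _.
rewrite le_eqVlt; apply/orP; left; apply/eqP.
field; rewrite !gt_eqF//.
by rewrite addrAC subrr add0r.
Qed.

Let gap (p : X -> R) x y : (forall x, 0 <= p x) -> (forall x y, p (x + y) <= p x + p y) ->
  p (x + y) ^+ 2 <= 2 * p x ^+ 2 + 2 * p y ^+ 2.
Proof.
move=> p0 pD; have : p (x + y) ^+ 2 <= (p x + p y) ^+ 2.
  by rewrite ler_sqr ?nnegrE ?addr_ge0// pD.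
by have := sqr_ge0 (p x - p y); nra.
Qed.

Definition pgap (p : X -> R) x y := 2 * p x ^+ 2 + 2 * p y ^+ 2 - p (x + y) ^+ 2.

Let sqsum_gap x y n : sqsum (x + y) n <= 2 * sqsum x n + 2 * sqsum y n.
Proof.
rewrite /sqsum /series /= !mulr_sumr -big_split /=; apply: ler_sum => j _.
have := ler_wpM2l (ltW (eps_gt0 j)) (gap x y (T_ge0 j) (TD j)); lra.
Qed.

(** No term of the sum has a negative defect, so none can offset the defect of
    another. *)
Lemma pgap_norm x y : pgap (fun x => `|x|) x y <= pgap sqnorm x y.
Proof.
rewrite /pgap !sqr_sqnorm; have := gap x y D_ge0 DD.
have : limn (sqsum (x + y)) <= 2 * limn (sqsum x) + 2 * limn (sqsum y).
  apply: lim_sqsum_le => n; apply: le_trans (sqsum_gap x y n) _.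
  by rewrite lerD// ler_pM2l// sqsum_le.
lra.
Qed.

Lemma pgap_term j x y : eps j * pgap (T_ j) x y <= pgap sqnorm x y.
Proof.
rewrite {2}/pgap !sqr_sqnorm; have := gap x y D_ge0 DD.
have := gap x y (@normr_ge0 _ _) (@ler_normD _ X).
have : limn (sqsum (x + y)) <=
    2 * limn (sqsum x) + 2 * limn (sqsum y) - eps j * pgap (T_ j) x y.
  apply: lim_sqsum_le => n; rewrite lerBrDr; pose m := maxn n j.+1.
  apply: (@le_trans _ _ (2 * sqsum x m + 2 * sqsum y m)); last first.
    by rewrite lerD// ler_pM2l// sqsum_le.
  apply: (@le_trans _ _ (sqsum (x + y) m + eps j * pgap (T_ j) x y)).
    by rewrite lerD2r; apply: sqsum_nd; exact: leq_maxl.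
  have jm : (j < m)%N by exact: leq_maxr.
  rewrite -lerBrDl /sqsum /series /= !mulr_sumr -big_split -sumrB /=.
  rewrite (@big_cat_nat _ _ _ j)//= ?(ltnW jm)// (big_ltn jm).
  have pos k : 0 <= 2 * (eps k * T_ k x ^+ 2) + 2 * (eps k * T_ k y ^+ 2) -
      eps k * T_ k (x + y) ^+ 2.
    have := ler_wpM2l (ltW (eps_gt0 k)) (gap x y (T_ge0 k) (TD k)); lra.
  have h1 := @sumr_ge0 _ _ (index_iota 0 j) xpredT _ (fun k _ => pos k).
  have h2 := @sumr_ge0 _ _ (index_iota j.+1 m) xpredT _ (fun k _ => pos k).
  rewrite /pgap; lra.
lra.
Qed.

End SquareSum.

(** * The norms on finitely supported functions *)

Section TriLevel.
Variables (R : realType) (S : choiceType) (F : nat -> set (set (Sbar S))).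
Hypothesis adm : admissible F.
Let hF := admissible_hereditary adm.
Implicit Types (z : c00 R (Sbar S)).

Let masses_ge0 z (G : set (Sbar S)) : 0 <= mass G z.
Proof. exact: mass_ge0. Qed.

Lemma c00_finite z : finite_set (supp z).
Proof. by case: z => z /= /asboolP. Qed.

Lemma c00_approximable j z : approximable (F j) (z : Sbar S -> R).
Proof.
move=> eps e0; exists (supp z); split; first exact: c00_finite.
move=> G FG; rewrite mass_eq0 ?ltW// => p [_ /negP].
by rewrite negbK => /eqP.
Qed.

Lemma c00_bounded j z : mass_bounded (F j) (z : Sbar S -> R).
Proof. exact: (approximable_bounded (hF j) (@c00_approximable j z)). Qed.

Lemma count_family (N : nat) (G : 'I_N -> set (Sbar S)) :
  (forall i k, i != k -> G i `&` G k = set0) <->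
  forall p, (count (fun H => p \in H) [seq G i | i <- enum 'I_N] <= 1)%N.
Proof.
split=> [dG p|cG i k ik].
  rewrite count_map -size_filter; set t := [seq i <- _ | _].
  have tu : uniq t by rewrite filter_uniq// enum_uniq.
  have tp i : i \in t -> G i p by rewrite mem_filter => /andP[/set_mem].
  move: tu tp; case: t => [|i [|k t]]//= /andP[+ _] tp.
  rewrite inE negb_or => /andP[ik _]; have /seteqP[+ _] := dG _ _ ik.
  by move=> /(_ p)[]; split; apply: tp; rewrite !inE eqxx ?orbT.
apply/seteqP; split=> // p [Gi Gk]; have := cG p; rewrite count_map -size_filter.
rewrite leqNgt => /negP; apply; apply: (@uniq_leq_size _ [:: i; k]).
  by rewrite /= inE ik.
by move=> l; rewrite !inE mem_filter mem_enum andbT => /orP[]/eqP -> /=; apply/mem_set.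
Qed.

(** The sets of a disjoint family can be listed in the order of decreasing mass,
    which turns its Day norm into [wnorm]; any other order gives less. *)
Lemma tri_levelE j z : tri_level F j z = tri (F j) z.
Proof.
have le_tri : ubound [set r | exists (N : nat) (G : 'I_N -> set (Sbar S)),
    [/\ forall i, F j (G i), forall i k, i != k -> G i `&` G k = set0
      & r = day_seq [seq Theta (G i) z | i <- enum 'I_N]]] (tri (F j) z).
  move=> _ [N [G [FG /count_family dG ->]]].
  rewrite (_ : [seq _ | i <- _] = map (masses z) [seq G i | i <- enum 'I_N]).
    rewrite day_seq_map//; apply: (wnorm_le_tri (hF j) (@c00_bounded j z)).
    apply: (@disjoint_perm _ _ [seq G i | i <- enum 'I_N]).
      by rewrite perm_sym perm_sort.
    by split=> // H /mapP[i _ ->].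
  by elim: (enum _) => [|i l IHl] //=; rewrite IHl.
apply/eqP; rewrite eq_le; apply/andP; split.
  apply: ge_sup => //; exists (day_seq [seq Theta set0 z | i <- enum 'I_0]).
  by exists 0%N, (fun=> set0); split=> // -[].
apply: tri_le => s [sF s1].
apply: (@le_trans _ _ (day_seq (map (masses z) s))).
  by rewrite day_seq_map// ler_sqrt ?wsq_ge0// wsq_sort.
apply: ub_le_sup; first by exists (tri (F j) z).
exists (size s), (fun i => nth set0 s i).
have sE : [seq nth set0 s (val i) | i <- enum 'I_(size s)] = s.
  by rewrite (map_comp (nth set0 s) val) val_enum_ord map_nth_iota0// take_size.
split; first by move=> i; apply: sF; exact: mem_nth.
  by apply/count_family; rewrite sE.
by rewrite -{1}sE -map_comp.
Qed.

(** Disjoint members of the first family are distinct singletons and empty sets.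
    The empty sets contribute nothing and can be dropped; the singletons at
    points of the support list a part of it. *)
Lemma day_c00E z : day_c00 z = tri (F 0%N) z.
Proof.
have F0 : F 0%N = [set A | A = set0 \/ exists p, A = [set p]] by case: adm.
rewrite /day_c00; set A : seq (Sbar S) := finmap.enum_fset _.
have Au : uniq A by exact: fset_uniq.
have AE p : (p \in A) = (z p != 0).
  by rewrite [LHS](in_fset_set (c00_finite z)); apply/idP/idP => [/set_mem|/mem_set].
have bz := @c00_bounded 0 z.
pose f p := `|z p|; have f0 p : 0 <= f p by exact: normr_ge0.
have -> : day_seq [seq z p | p <- A] = day_seq (map f A).
  by rewrite day_seq_norm -map_comp.
apply/eqP; rewrite eq_le; apply/andP; split.
  rewrite (_ : map f A = map (masses z) [seq [set p] | p <- A]); last first.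
    by rewrite -map_comp; apply: eq_map => p /=; rewrite mass1.
  rewrite day_seq_map//; apply: (wnorm_le_tri (hF 0) bz).
  apply: (@disjoint_perm _ _ [seq [set p] | p <- A]).
    by rewrite perm_sym perm_sort.
  split=> [G /mapP[p _ ->]|p]; first by rewrite F0; right; exists p.
  rewrite count_map (eq_count (a2 := pred1 p)) ?count_uniq_mem ?leq_b1//.
  move=> q /=; apply/idP/eqP => [/set_mem ->//|->]; exact/mem_set.
apply: tri_le => s [sF s1].
pose s' := [seq G <- s | 0 < mass G z].
have sE : wsq (masses z) s <= wsq (masses z) s'.
  apply: le_trans (wsq_filter 0 s (masses_ge0 z)) _; rewrite wsq_cat0//.
  by move=> G; rewrite mem_filter -leNgt => /andP[G0 _]; apply/eqP; rewrite eq_le G0 mass_ge0.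
have s'1 p : (count (fun G => p \in G) s' <= 1)%N.
  by apply: leq_trans (s1 p); rewrite count_filter; apply: sub_count => G /andP[].
have s'E G : G \in s' -> exists2 p, z p != 0 & G = [set p].
  rewrite mem_filter => /andP[G0 /sF]; rewrite F0 => -[GE|[p GE]].
    by rewrite GE mass0 ltxx in G0.
  by exists p => //; move: G0; rewrite GE mass1 normr_gt0.
have [t [tu tA st]] : exists t, [/\ uniq t, {subset t <= A} & s' = [seq [set p] | p <- t]].
  elim: s' {sE} s'1 s'E => [|G u IHu] u1 uE; first by exists [::].
  have [||t [tu tA ut]] := IHu.
  - by move=> p; apply: leq_trans (u1 p); rewrite /= leq_addl.
  - by move=> H Hu; apply: uE; rewrite inE Hu orbT.
  have [p zp GE] := uE _ (mem_head _ _); exists (p :: t); split=> /=.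
  - rewrite tu andbT; apply/negP => pt; have := u1 p.
    rewrite /= GE (mem_set (erefl p : [set p] p)) leqNgt ltnS => /negP; apply.
    rewrite -has_count; apply/hasP; exists [set p]; last by apply/mem_set.
    by rewrite ut; apply/mapP; exists p.
  - by move=> q; rewrite inE => /orP[/eqP->|/tA//]; rewrite AE.
  - by rewrite GE ut.
apply: (@le_trans _ _ (wnorm (masses z) s')); first by rewrite ler_sqrt ?wsq_ge0.
apply: (@le_trans _ _ (wnorm f (t ++ [seq p <- A | p \notin t]))).
  rewrite /wnorm ler_sqrt ?wsq_ge0// st wsq_map; apply: le_trans (wsq_cat_le _ _ _).
  by rewrite (@eq_wsq _ _ _ f)// => p _ /=; rewrite mass1.
rewrite (@day_seq_perm _ (map f A) (map f (t ++ [seq p <- A | p \notin t]))).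
  by rewrite day_seq_map// ler_sqrt ?wsq_ge0// wsq_sort.
apply: perm_map; apply: uniq_perm => //.
  rewrite cat_uniq tu filter_uniq// andbT /=; apply/hasP => -[p].
  by rewrite mem_filter => /andP[/negP].
move=> p; rewrite mem_cat mem_filter; have [pt|pt] /= := boolP (p \in t); last by [].
exact: tA.
Qed.

End TriLevel.

(** * Coordinates on the completion *)

Section Extension.
Variables (R : realType) (E : lmodType R) (X : completeNormedModType R).
Variable iota : {linear E -> X}.
Hypothesis iota_dense : dense (range iota).

Lemma dense_near x eps : 0 < eps -> exists z, `|x - iota z| < eps.
Proof.
move=> e0; have [|y [xy [z _ zy]]] := iota_dense (O := ball x eps) _ (ball_open x eps).
  by exists x; apply: ballxx.
by exists z; rewrite zy; move: xy; rewrite -ball_normE.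
Qed.

Lemma extensionE N (g : X -> R) : continuous (g : X -> R^o) ->
  (forall z, g (iota z) = N z) -> extension iota N = g.
Proof.
move=> gc gN.
have [hc hN] : [set h : X -> R | continuous h /\ forall z, h (iota z) = N z]
    (extension iota N).
  by apply: getPex; exists g.
set h := extension iota N in hc hN *; apply/funext => x; apply/eqP.
rewrite -subr_eq0 -normr_le0; apply/ler_addgt0Pr => eps e0; rewrite add0r.
have e2 : 0 < eps / 2 by rewrite divr_gt0.
have /cvgrPdist_le/(_ _ e2) hx := hc x; have /cvgrPdist_le/(_ _ e2) gx := gc x.
have [d /= d0 hd] := (nbhs_ballP x _).1 (filterI hx gx).
have [z xz] := dense_near x d0.
have xz' : ball x d (iota z) by rewrite -ball_normE.
have [/=] := hd _ xz'.
rewrite hN gN => h1 h2; rewrite (splitr eps).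
rewrite (_ : h x - g x = (h x - N z) - (g x - N z)); last by ring.
by apply: le_trans (ler_normB _ _) _; rewrite lerD.
Qed.

End Extension.

Section Coordinates.
Variables (R : realType) (S : choiceType) (F : nat -> set (set (Sbar S))).
Hypothesis adm : admissible F.
Variables (Y : completeNormedModType R) (e : nat -> Y) (c C : R).
Hypotheses (c0 : 0 < c) (ec : forall j, c <= `|e j| <= C).
Hypothesis unc : one_unconditional e.
Variables (X : completeNormedModType R) (iota : {linear c00 R (Sbar S) -> X}).
Hypothesis comp : is_completion iota (norm_c00 F e).
Implicit Types (z : c00 R (Sbar S)) (x y : X) (p : Sbar S) (v : Sbar S -> R).

Let hF := admissible_hereditary adm.
Let iota_dense : dense (range iota). Proof. by case: comp. Qed.

(** The coefficients, in the basis [e], of the norm of [X] at [v]. *)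
Definition wlev v j : R := 2 ^- j * lev (F j) v.

Lemma wlev_ge0 v j : mass_bounded (F j) v -> 0 <= wlev v j.
Proof.
by move=> bv; rewrite mulr_ge0 ?invr_ge0 ?exprn_ge0// (lev_ge0 (hF j)).
Qed.

Lemma wlev_c00_cvg z : cvgn (expansion e (wlev z)).
Proof.
apply: normed_cvg.
have C0 : 0 <= C by have /andP[h1 h2] := ec 0; rewrite (le_trans _ h2)// (le_trans _ h1)// ltW.
pose M := mass (supp z) z.
have levM j : lev (F j) z <= M.
  apply: (lev_le (hF j)) => G FG.
  have fG : finite_set G by case: (hF j) => + _ _ _; apply.
  rewrite (massID (supp z) _ fG) [X in _ + X]mass_eq0 ?addr0.
    by apply: mass_le; [exact: c00_finite|exact: subIsetr].
  by move=> p [_ /negP]; rewrite negbK => /eqP.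
apply: (@series_le_cvg _ _ (geometric (M * C) 2^-1)).
- by move=> n /=.
- by move=> n /=; rewrite !mulr_ge0 ?mass_ge0// exprn_ge0// invr_ge0.
- move=> n /=; rewrite normrZ ger0_norm ?wlev_ge0//; last exact: c00_bounded.
  rewrite [leRHS]mulrC exprVn /wlev -mulrA ler_wpM2l ?invr_ge0 ?exprn_ge0//.
  have l0 := lev_ge0 (hF n) (c00_bounded adm n z); have /andP[_ en] := ec n.
  by rewrite ler_pM.
- by apply: is_cvg_geometric_series; rewrite ger0_norm ?invr_ge0// invf_lt1// ltr1n.
Qed.

Lemma iota_norm z : `|iota z| = `|limn (expansion e (wlev z))|.
Proof. by case: comp => ->. Qed.

Lemma lev_c00 z j : lev (F j) z <= 2 ^+ j / c * `|iota z|.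
Proof.
have h : `|wlev z j *: e j| <= `|iota z|.
  rewrite iota_norm; apply: le_trans (psum_le_lim unc j.+1 (@wlev_c00_cvg z)).
  rewrite (_ : wlev z j *: e j = psum e (fun k => if k == j then wlev z k else 0) j.+1).
    by apply: psum_mono => // k; case: ifP => // _; rewrite normr0.
  rewrite /psum big_nat_recr//= eqxx big_nat_cond big1 ?add0r// => k /andP[/andP[_ kj] _].
  by rewrite lt_eqF// scale0r.
rewrite mulrAC ler_pdivlMr//; rewrite -ler_pdivrMl ?exprn_gt0//.
apply: le_trans h; rewrite normrZ ger0_norm ?wlev_ge0//; last exact: c00_bounded.
rewrite mulrA; apply: ler_wpM2l; first by apply: wlev_ge0; exact: c00_bounded.
by case/andP: (ec j).
Qed.

Lemma c00_coordinate z p : `|z p| <= c^-1 * `|iota z|.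
Proof.
have := lev_c00 z 0; rewrite expr0 mul1r; apply: le_trans.
rewrite -mass1; apply: (mass_le_lev (c00_bounded adm 0 z)).
by case: (hF 0).
Qed.

(** The McShane extension of a coordinate, which is [c^-1]-Lipschitz on the
    dense subspace. *)
Definition co x p : R := sup [set z p - c^-1 * `|x - iota z| | z in [set: c00 R (Sbar S)]].

Lemma coP x z p : `|co x p - z p| <= c^-1 * `|x - iota z|.
Proof.
have h z' (w : c00 R (Sbar S)) : z' p - c^-1 * `|x - iota z'| <= w p + c^-1 * `|x - iota w|.
  have := c00_coordinate (z' - w) p; rewrite linearB.
  change (`|z' p - w p| <= c^-1 * `|iota z' - iota w| ->
    z' p - c^-1 * `|x - iota z'| <= w p + c^-1 * `|x - iota w|).
  have : c^-1 * `|iota z' - iota w| <= c^-1 * `|x - iota z'| + c^-1 * `|x - iota w|.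
    rewrite -mulrDr ler_pM2l ?invr_gt0// (_ : iota z' - iota w = (x - iota w) - (x - iota z')).
      by rewrite [leRHS]addrC; exact: ler_normB.
    by rewrite opprB [RHS]addrC addrA subrK.
  have := ler_norm (z' p - w p); lra.
have h1 : co x p <= z p + c^-1 * `|x - iota z|.
  apply: ge_sup; first by exists (z p - c^-1 * `|x - iota z|), z.
  by move=> _ [z' _ <-].
have h2 : z p - c^-1 * `|x - iota z| <= co x p.
  apply: ub_le_sup; last by exists z.
  by exists (z p + c^-1 * `|x - iota z|) => _ [z' _ <-].
by rewrite ler_norml; lra.
Qed.

Lemma co_iota z : co (iota z) = z :> (_ -> R).
Proof.
apply/funext => p; apply/eqP; rewrite -subr_eq0 -normr_le0.
by apply: le_trans (coP _ z p) _; rewrite subrr normr0 mulr0.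
Qed.

Lemma coL a x y p : co (a *: x + y) p = a * co x p + co y p.
Proof.
apply/eqP; rewrite -subr_eq0; apply/eqP.
apply: (@small_eq0 _ _ (2 * c^-1 * (`|a| + 1))) => eps e0.
have [z xz] := dense_near iota_dense x e0; have [w yw] := dense_near iota_dense y e0.
have h1 := coP x z p; have h2 := coP y w p.
have h3 : `|co (a *: x + y) p - (a * z p + w p)| <= c^-1 * `|a *: x + y - iota (a *: z + w)|.
  exact: (coP (a *: x + y) (a *: z + w) p).
have ci : 0 < c^-1 by rewrite invr_gt0.
have k1 : c^-1 * `|x - iota z| <= c^-1 * eps by rewrite ler_pM2l// ltW.
have k2 : c^-1 * `|y - iota w| <= c^-1 * eps by rewrite ler_pM2l// ltW.
have k3 : c^-1 * `|a *: x + y - iota (a *: z + w)| <= c^-1 * (`|a| * eps + eps).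
  rewrite ler_pM2l// linearP opprD addrACA -scalerBr.
  apply: le_trans (ler_normD _ _) _; rewrite normrZ lerD ?ler_wpM2l// ltW//.
have k4 : `|a * co x p - a * z p| <= `|a| * (c^-1 * eps).
  by rewrite -mulrBr normrM ler_wpM2l// (le_trans h1).
rewrite (_ : _ - _ = (co (a *: x + y) p - (a * z p + w p)) -
  (a * co x p - a * z p) - (co y p - w p)); last by ring.
apply: le_trans (ler_normB _ _) _; apply: le_trans (lerD (ler_normB _ _) (lexx _)) _.
nra.
Qed.

Lemma coD x y : co (x + y) = co x \+ co y.
Proof. by apply/funext => p; rewrite -[x]scale1r coL mul1r scale1r. Qed.

Lemma coB x y : co (x - y) = co x \- co y.
Proof.
by apply/funext => p; rewrite addrC -scaleN1r coL mulN1r addrC.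
Qed.

Lemma coZ a x : co (a *: x) = fun p => a * co x p.
Proof.
apply/funext => p; have co0 : co 0 p = 0 by rewrite -(linear0 iota) co_iota.
by rewrite -[a *: x]addr0 coL co0 addr0.
Qed.

Lemma co_le x p : `|co x p| <= c^-1 * `|x|.
Proof.
have := coP x 0 p; rewrite (linear0 iota) (subr0 x).
by change (`|co x p - 0| <= c^-1 * `|x| -> `|co x p| <= c^-1 * `|x|); rewrite subr0.
Qed.

Lemma co_dual p : (fun x => co x p) \in @is_dual R X.
Proof.
apply/asboolP; split; first by move=> a x y; exact: coL.
apply: (@lipschitz_continuous _ _ _ c^-1) => x y.
by have := co_le (x - y) p; rewrite coB.
Qed.

(** On a fixed finite set the coordinates depend continuously on the point, so
    the bound passes from the dense subspace to its completion. *)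
Lemma mass_co x j G : F j G -> mass G (co x) <= 2 ^+ j / c * `|x|.
Proof.
move=> FG; have fG : finite_set G by case: (hF j) => + _ _ _; apply.
set k := 2 ^+ j / c; have k0 : 0 <= k by rewrite divr_ge0 ?exprn_ge0// ltW.
pose n : R := (\sum_(p <- fset_set G) c^-1).
have n0 : 0 <= n by rewrite sumr_ge0// => p _; rewrite invr_ge0 ltW.
apply/ler_addgt0Pr => eps e0.
have nk : 0 < n + k + 1 by rewrite ltr_wpDl// addr_ge0.
have [z xz] := dense_near iota_dense x (divr_gt0 e0 nk).
set d := eps / (n + k + 1) in xz.
have dE : d * (n + k + 1) = eps by rewrite /d divfK// gt_eqF.
have h1 := massB (co x) z fG.
have h2 : mass G (co x \- z) <= n * `|x - iota z|.
  rewrite -{1}co_iota -coB massE// /n mulr_suml; apply: ler_sum => p _; exact: co_le.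
have h3 : mass G z <= k * `|iota z|.
  by apply: le_trans (lev_c00 z j); apply: (mass_le_lev (c00_bounded adm j z)).
have h4 : `|iota z| <= `|x| + `|x - iota z|.
  by rewrite -{1}(subKr x (iota z)); exact: ler_normB.
have h5 : n * `|x - iota z| <= n * d by rewrite ler_wpM2l// ltW.
have h6 : k * `|iota z| <= k * (`|x| + d).
  by rewrite ler_wpM2l// (le_trans h4)// lerD2l ltW.
have d0 : 0 < d by rewrite divr_gt0.
rewrite mulrDr in h6; lra.
Qed.

Lemma co_bounded x j : mass_bounded (F j) (co x).
Proof. by exists (2 ^+ j / c * `|x|) => G; exact: mass_co. Qed.

Lemma lev_co x j : lev (F j) (co x) <= 2 ^+ j / c * `|x|.
Proof. by apply: (lev_le (hF j)) => G; exact: mass_co. Qed.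

Lemma co_approximable x j : approximable (F j) (co x).
Proof.
move=> eps e0; have k0 : 0 < 2 ^+ j / c by rewrite divr_gt0// exprn_gt0.
have [z xz] := dense_near iota_dense x (divr_gt0 e0 k0).
exists (supp z); split; first exact: c00_finite.
move=> G FG; have FG' : F j (G `\` supp z).
  by case: (hF j) => _ h _ _; apply: h FG _; exact: subDsetl.
have fG : finite_set (G `\` supp z) by case: (hF j) => + _ _ _; apply.
apply: le_trans (massB _ z fG) _; rewrite mass_eq0 ?add0r.
  have -> : co x \- z = co (x - iota z) by rewrite coB co_iota.
  apply: le_trans (mass_co _ FG') _.
  by rewrite mulrC -ler_pdivlMr// ltW.
by move=> p [_ /negP]; rewrite negbK => /eqP.
Qed.

Lemma tri_co_continuous j : continuous ((fun x => tri (F j) (co x)) : X -> R^o).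
Proof.
apply: (@lipschitz_continuous _ _ _ (2 ^+ j / c)) => x y.
have h x' y' : tri (F j) (co x') <= tri (F j) (co y') + 2 ^+ j / c * `|x' - y'|.
  rewrite -{1}(subrK y' x') addrC coD.
  apply: le_trans (triD (hF j) (co_bounded _ _) (co_bounded _ _)) _.
  rewrite lerD2l; apply: le_trans (lev_co _ _).
  exact: (tri_le_lev (hF j) (co_bounded _ _)).
by have := h x y; have := h y x; rewrite (distrC y x) ler_norml; lra.
Qed.

Lemma tri_extE j : tri_ext F iota j = fun x => tri (F j) (co x).
Proof.
apply: (extensionE iota_dense); first exact: tri_co_continuous.
by move=> z; rewrite co_iota tri_levelE.
Qed.

Lemma day_extE : day_ext iota = fun x => tri (F 0%N) (co x).
Proof.
apply: (extensionE iota_dense); first exact: tri_co_continuous.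
by move=> z; rewrite co_iota (day_c00E adm).
Qed.

Lemma psum_co_small x K : `|psum e (wlev (co x)) K| <= K%:R * (C / c) * `|x|.
Proof.
rewrite /psum; apply: le_trans (ler_norm_sum _ _ _) _.
apply: (@le_trans _ _ (\sum_(0 <= j < K) C / c * `|x|)).
  apply: ler_sum => j _; rewrite normrZ ger0_norm; last exact/wlev_ge0/co_bounded.
  have /andP[_ eC] := ec j.
  have l0 := wlev_ge0 (co_bounded x j).
  have lx : wlev (co x) j <= c^-1 * `|x|.
    rewrite /wlev ler_pdivrMl ?exprn_gt0// mulrA; exact: lev_co.
  by rewrite -mulrA mulrC; apply: ler_pM.
by rewrite sumr_const_nat subn0 -[leLHS]mulr_natl mulrA.
Qed.

Lemma wlev_co_add x y j : wlev (co x) j <= wlev (co y) j + wlev (co (x - y)) j.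
Proof.
rewrite /wlev -mulrDr ler_wpM2l ?invr_ge0 ?exprn_ge0//.
rewrite {1}(_ : co x = co y \+ co (x - y)); last by rewrite -coD addrC subrK.
exact: (levD (hF j) (co_bounded y j) (co_bounded (x - y) j)).
Qed.

Lemma psum_co_add x y J K : `|psum e (tail (wlev (co x)) J) K| <=
  `|psum e (tail (wlev (co y)) J) K| + `|psum e (tail (wlev (co (x - y))) J) K|.
Proof.
apply: psum_add_le => // j; rewrite wlev_co_add andbT.
exact/wlev_ge0/co_bounded.
Qed.

Lemma psum_co_le x K : `|psum e (wlev (co x)) K| <= `|x|.
Proof.
apply/ler_addgt0Pr => eps e0; set k := K%:R * (C / c).
have k0 : 0 < `|k| + 1 by rewrite ltr_wpDl.
have [z xz] := dense_near iota_dense x (divr_gt0 e0 (addr_gt0 k0 ltr01)).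
set d := eps / (`|k| + 1 + 1) in xz.
have dE : d * (`|k| + 1 + 1) = eps by rewrite /d divfK// gt_eqF// addr_gt0.
have h1 := psum_co_add x (iota z) 0 K.
have h2 : `|psum e (wlev (co (iota z))) K| <= `|iota z|.
  by rewrite iota_norm co_iota; exact: (psum_le_lim unc K (@wlev_c00_cvg z)).
have h3 : `|psum e (wlev (co (x - iota z))) K| <= `|k| * d.
  apply: le_trans (psum_co_small _ _) _.
  apply: (@le_trans _ _ (`|k| * `|x - iota z|)); first by rewrite ler_wpM2r// ler_norm.
  by rewrite ler_wpM2l// ltW.
have h4 : `|iota z| <= `|x| + `|x - iota z|.
  by rewrite -{1}(subKr x (iota z)); exact: ler_normB.
have h1' : `|psum e (wlev (co x)) K| <= `|psum e (wlev (co (iota z))) K| +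
   `|psum e (wlev (co (x - iota z))) K| by exact: h1.
have d0 : 0 < d by rewrite divr_gt0// addr_gt0.
lra.
Qed.

Lemma tail_co_le x J K : `|psum e (tail (wlev (co x)) J) K| <= `|x|.
Proof.
apply: le_trans (psum_co_le x K); apply: psum_mono => // j.
by rewrite /tail; case: ifP => // _; rewrite normr0.
Qed.

Lemma wlev_co_cvg x : cvgn (expansion e (wlev (co x))).
Proof.
apply: tails_cvg => // eps e0; have e2 : 0 < eps / 2 by rewrite divr_gt0.
have [z xz] := dense_near iota_dense x e2.
have [J hJ] := expansion_tail (@wlev_c00_cvg z) e2; exists J => K.
apply: le_trans (psum_co_add x (iota z) J K) _; rewrite (splitr eps) lerD//.
  by rewrite co_iota.
by apply: le_trans (tail_co_le _ _ _) _; exact: ltW.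
Qed.

(** Both sides are 1-Lipschitz, and they agree on a dense subspace. *)
Lemma norm_co x : `|x| = `|limn (expansion e (wlev (co x)))|.
Proof.
apply/eqP; rewrite eq_le; apply/andP; split; last first.
  apply: (@cvg_norm_le _ _ (expansion e (wlev (co x))) _ _ 0%N); first exact: wlev_co_cvg.
  by move=> n _; rewrite expansionE; exact: psum_co_le.
apply/ler_addgt0Pr => eps e0; have e2 : 0 < eps / 2 by rewrite divr_gt0.
have [z xz] := dense_near iota_dense x e2.
have h1 : `|iota z| <= `|limn (expansion e (wlev (co x)))| + `|x - iota z|.
  rewrite iota_norm; apply: (@cvg_norm_le _ _ (expansion e (wlev z)) _ _ 0%N).
    exact: wlev_c00_cvg.
  move=> n _; rewrite expansionE; have := psum_co_add (iota z) x 0 n.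
  rewrite co_iota => /le_trans; apply; rewrite lerD//.
    exact: (psum_le_lim unc n (@wlev_co_cvg x)).
  by rewrite distrC; exact: tail_co_le.
have h4 : `|x| <= `|iota z| + `|x - iota z|.
  by rewrite -{1}(subrK (iota z) x) addrC; exact: ler_normD.
lra.
Qed.

End Coordinates.

(** * The equivalence *)

Section Main.
Variables (R : realType) (S : choiceType) (F : nat -> set (set (Sbar S))).
Hypothesis adm : admissible F.
Variables (Y : completeNormedModType R) (e : nat -> Y) (c C : R).
Hypotheses (c0 : 0 < c) (ec : forall j, c <= `|e j| <= C).
Hypothesis unc : one_unconditional e.
Variables (X : completeNormedModType R) (iota : {linear c00 R (Sbar S) -> X}).
Hypothesis comp : is_completion iota (norm_c00 F e).
Variable eps : nat -> R.
Hypothesis fast : eps_fast F iota eps.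

Let hF := admissible_hereditary adm.
Let co := co c iota.
Let bco := co_bounded adm c0 ec unc comp.
Let aco := co_approximable adm c0 ec unc comp.
Let T_ j x := tri (F j) (co x).
Let N := norm_star F iota eps.

Let T_ge0 j x : 0 <= T_ j x. Proof. exact: (tri_ge0 (hF j) (bco x j)). Qed.

Let TD j x y : T_ j (x + y) <= T_ j x + T_ j y.
Proof. by rewrite /T_ /co (coD adm c0 ec unc comp); apply: triD => //; exact: bco. Qed.

Let TZ j a x : T_ j (a *: x) = `|a| * T_ j x.
Proof.
have le b y : T_ j (b *: y) <= `|b| * T_ j y.
  by rewrite /T_ /co (coZ adm c0 ec unc comp); apply: triZ => //; exact: bco.
apply/eqP; rewrite eq_le le /=; have [->|a0] := eqVneq a 0.
  by rewrite normr0 mul0r.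
rewrite -ler_pdivlMl ?normr_gt0// -normfV; apply: le_trans (le _ _).
by rewrite scalerA mulVf// scale1r.
Qed.

Let NE : N = sqnorm (T_ 0) T_ eps.
Proof.
apply/funext => x; rewrite /N /norm_star /star_series /sqnorm /sqsum.
rewrite (day_extE adm c0 ec unc comp).
rewrite (_ : tri_ext F iota = T_)//; apply/funext => j.
exact: (tri_extE adm c0 ec unc comp).
Qed.

Let eps_gt0 j : 0 < eps j. Proof. by case: fast. Qed.

Let sq_cvg x : cvgn (sqsum T_ eps x).
Proof.
case: fast => _ _ + _; move=> /(_ x); rewrite /star_series /sqsum.
rewrite (_ : tri_ext F iota = T_)//; apply/funext => j.
exact: (tri_extE adm c0 ec unc comp).
Qed.

Let ND x y : N (x + y) <= N x + N y.
Proof. by rewrite NE; exact: (sqnormD (T_ge0 0) (TD 0) T_ge0 TD eps_gt0 sq_cvg). Qed.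

Let NZ a x : N (a *: x) = `|a| * N x.
Proof. by rewrite NE; exact: (sqnormZ (TZ 0) TZ sq_cvg). Qed.

Lemma star_rotund_reflexive : two_rotund N -> reflexive_space X.
Proof.
move=> rot; have [_ _ _ [k [K [k0 kK]]]] := fast.
by apply: (two_rotund_reflexive (C := K) ND NZ k0 _ _ rot) => x; case/andP: (kK x).
Qed.

Section Converse.
Hypotheses (rotY : two_rotund (fun y : Y => `|y|)) (reflX : reflexive_space X).
Variable u : nat -> X.
Hypotheses (u1 : forall n, N (u n) <= 1)
  (u2 : N (u mn.1 + u mn.2) @[mn --> (\oo, \oo)] --> (2 : R)).

Let pgapN d : 0 < d -> exists K : nat, forall m n, (K <= m)%N -> (K <= n)%N ->
  pgap N (u m) (u n) <= d.
Proof.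
move=> d0; have d4 : 0 < d / 4 by rewrite divr_gt0.
have [K hK] := (cvg_pairP (fun m n => N (u m + u n)) 2).1 u2 _ d4.
exists K => m n Km Kn; have := hK m n Km Kn; rewrite ler_norml /pgap => /andP[_ h].
have N0 x : 0 <= N x by rewrite NE sqnorm_ge0.
have sq x : N x <= 1 -> N x ^+ 2 <= 1 by move=> x1; rewrite expr_le1.
have h1 := sq _ (u1 m); have h2 := sq _ (u1 n); have := N0 (u m + u n); nra.
Qed.

Let pgapT j d : 0 < d -> exists K : nat, forall m n, (K <= m)%N -> (K <= n)%N ->
  pgap (T_ j) (u m) (u n) <= d.
Proof.
move=> d0; have [K hK] := pgapN (mulr_gt0 (eps_gt0 j) d0).
exists K => m n Km Kn; rewrite -(ler_pM2l (eps_gt0 j)); apply: le_trans (hK m n Km Kn).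
by rewrite NE; exact: (pgap_term (T_ge0 0) (TD 0) T_ge0 TD eps_gt0 sq_cvg).
Qed.

Let wl n := wlev F (co (u n)).

Let wl_cvg n : cvgn (expansion e (wl n)).
Proof. exact: (wlev_co_cvg adm c0 ec unc comp). Qed.

(** Level norms are subadditive and [psum_mono] makes the norm of [Y] monotone,
    so the sum of two level vectors has norm at least that of the sum of the two
    points, and the rotundity of [Y] applies. *)
Let level_vectors_cvg : cvgn (fun n => limn (expansion e (wl n))).
Proof.
apply: two_rotund_parallelogram => // d d0.
have [K hK] := pgapN d0; exists K => m n Km Kn.
have h1 : pgap (fun x => `|x|) (u m) (u n) <= d.
  apply: le_trans (hK m n Km Kn).
  by rewrite NE; exact: (pgap_norm (T_ge0 0) (TD 0) T_ge0 TD eps_gt0 sq_cvg).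
rewrite /pgap in h1; rewrite -!(norm_co adm c0 ec unc comp).
apply: le_trans h1; rewrite lerD2l lerN2 ler_sqr ?nnegrE//.
rewrite [leLHS](norm_co adm c0 ec unc comp).
apply: (@cvg_norm_le _ _ (expansion e (wlev F (co (u m + u n)))) _ _ 0%N).
  exact: (wlev_co_cvg adm c0 ec unc comp).
move=> k _; rewrite expansionE.
apply: (@le_trans _ _ `|psum e (fun j => wl m j + wl n j) k|).
  apply: psum_mono => // j.
  have w0 x : 0 <= wlev F (co x) j by exact/(wlev_ge0 adm)/bco.
  rewrite (ger0_norm (w0 _)) (ger0_norm (addr_ge0 (w0 _) (w0 _))).
  rewrite /wl /wlev -mulrDr ler_wpM2l ?invr_ge0 ?exprn_ge0//.
  by rewrite /co (coD adm c0 ec unc comp); exact: (levD (hF j) (bco _ _) (bco _ _)).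
apply: (psum_le_lim unc).
rewrite (_ : expansion e _ = expansion e (wl m) \+ expansion e (wl n)).
  exact: cvgD (@wl_cvg m) (@wl_cvg n).
apply/funext => i /=; rewrite !expansionE /psum -big_split; apply: eq_bigr => j _.
by rewrite scalerDl.
Qed.

Section Ultra.
Variable U : set_system nat.
Hypotheses (UU : UltraFilter U) (Uoo : \oo `<=` U).

Let PU : ProperFilter U. Proof. exact: ultra_proper. Qed.

Let u_bounded : exists M, forall n, `|u n| <= M.
Proof.
exists 1 => n; apply: le_trans (u1 n); rewrite NE.
exact: (sqnorm_norm (T_ 0) eps_gt0 sq_cvg).
Qed.

(** The limits along [U] of the values of functionals define an element of the
    bidual, which reflexivity represents by a point. *)
Lemma weak_ultralimit : exists x : X, forall (f : cdual X) d, 0 < d ->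
  \forall n \near U, `|f (u n) - f x| <= d.
Proof.
have [M uM] := u_bounded.
have /choice[phi phiE] (f : cdual X) : exists r : R, forall d, 0 < d ->
    \forall n \near U, `|f (u n) - r| <= d.
  apply: (ultra_bounded_cvg UU (M := `|f| * M)) => n.
  by apply: le_trans (dual_norm_ub _ _) _; rewrite ler_wpM2l.
have phiL : linear (phi : cdual X -> R^o).
  move=> a f g; change (phi (a *: f + g) = a * phi f + phi g).
  apply/eqP; rewrite -subr_eq0; apply/eqP.
  apply: (@small_eq0 _ _ (`|a| + 2)) => d d0.
  have [n [[h1 h2] h3]] := filter_ex (filterI (filterI (phiE f d d0) (phiE g d d0))
    (phiE (a *: f + g) d d0)).
  change (is_true (`|(a * f (u n) + g (u n)) - phi (a *: f + g)| <= d)) in h3.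
  have h4 : `|a * f (u n) - a * phi f| <= `|a| * d by rewrite -mulrBr normrM ler_wpM2l.
  rewrite (_ : _ - _ = (a * f (u n) - a * phi f) + (g (u n) - phi g) -
     (a * f (u n) + g (u n) - phi (a *: f + g))); last by ring.
  apply: le_trans (ler_normB _ _) _; apply: le_trans (lerD (ler_normD _ _) (lexx _)) _.
  by rewrite mulrDl; lra.
have phi_le f : `|phi f| <= M * `|f|.
  apply/ler_addgt0Pr => d d0; have [n h] := filter_ex (phiE f d d0).
  have := dual_norm_ub f (u n); have := ler_wpM2l (normr_ge0 f) (uM n).
  have := ler_normB (f (u n)) (f (u n) - phi f); rewrite subKr; lra.
have phi_dual : (phi : cdual X -> R^o) \in @is_dual R (cdual X).
  apply/asboolP; split=> //; apply: (@lipschitz_continuous _ _ _ M) => f g.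
  rewrite (_ : phi f - phi g = phi (f - g)) ?phi_le//.
  have E : phi (-1 *: g + f) = -1 * phi g + phi f := phiL (-1) g f.
  by rewrite (addrC f (- g)) -(scaleN1r g) E mulN1r addrC.
have [x xE] := reflX (CDual phi_dual); exists x => f d d0.
by rewrite -xE; exact: phiE.
Qed.

Lemma pointwise_ultralimit (x : X) : (forall (f : cdual X) d, 0 < d ->
    \forall n \near U, `|f (u n) - f x| <= d) ->
  pointwise U (fun n => co (u n)) (co x).
Proof.
by move=> xU p d d0; exact: (xU (CDual (co_dual adm c0 ec unc comp p)) d d0).
Qed.

Let near_all J (P : nat -> nat -> Prop) : (forall j, \forall n \near U, P j n) ->
  \forall n \near U, forall j, (j < J)%N -> P j n.
Proof.
move=> h; elim: J => [|J IHJ]; first exact: nearW.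
near=> n => j; rewrite ltnS leq_eqVlt => /orP[/eqP->|]; first by near: n; exact: h.
by move: j; near: n; exact: IHJ.
Unshelve. all: by end_near. Qed.

(** The first [J] levels converge, and beyond them [u n] and [x] have small
    tails. *)
Lemma norm_ultralimit : exists x : X, forall d, 0 < d -> \forall n \near U, `|u n - x| <= d.
Proof.
have [x /pointwise_ultralimit xU] := weak_ultralimit; exists x => d d0.
have par j : parallelogram_small (F j) U (fun n => co (u n)).
  move=> eta eta0; have [K hK] := pgapT j eta0.
  have hU : \forall n \near U, (K <= n)%N by apply: Uoo; exists K.
  near=> n; near=> m; rewrite -(coD adm c0 ec unc comp).
  by apply: hK; [near: n|near: m].
have lev_small j r : 0 < r -> \forall n \near U, lev (F j) (co (u n - x)) <= r.
  move=> r0; have := levels_converge adm PU (fun j n => aco (u n) j) (fun j => aco x j)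
    xU par j r0.
  apply: filterS => n h; rewrite /co (coB adm c0 ec unc comp).
  by apply: (lev_le (hF j)) => G; exact: h.
have d4 : 0 < d / 4 by rewrite divr_gt0.
have [K [J1 hJ1]] := uniform_tails unc wl_cvg level_vectors_cvg d4.
have [J2 hJ2] := expansion_tail (wlev_co_cvg adm c0 ec unc comp (x := x)) d4.
pose J := maxn J1 J2; pose r := d / 4 / (J%:R * `|C| + 1).
have rJ : 0 < J%:R * `|C| + 1 by rewrite ltr_wpDl// mulr_ge0.
have r0 : 0 < r by rewrite divr_gt0.
near=> n.
have nK : (K <= n)%N by near: n; apply: Uoo; exists K.
have nlev j : (j < J)%N -> lev (F j) (co (u n - x)) <= r.
  by move: j; near: n; apply: near_all => j; exact: lev_small.
rewrite (norm_co adm c0 ec unc comp).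
apply: (@cvg_norm_le _ _ (expansion e (wlev F (co (u n - x)))) _ _ 0%N).
  exact: (wlev_co_cvg adm c0 ec unc comp).
move=> k _; rewrite expansionE; set a := wlev F (co (u n - x)).
have w0 y j : 0 <= wlev F (co y) j by exact/(wlev_ge0 adm)/bco.
pose b j : R := if (j < J)%N then a j else 0.
pose s j : R := tail (wl n) J j + tail (wlev F (co x)) J j.
have h1 : `|psum e a k| <= `|psum e b k| + `|psum e s k|.
  apply: (psum_add_le (a := a) (b := b) (d := s) unc 0 k) => j.
  rewrite w0 /b /s /tail; case: ltnP => _ /=; first by rewrite !addr0.
  rewrite add0r /a /wl /wlev -mulrDr ler_wpM2l ?invr_ge0 ?exprn_ge0//.
  by rewrite /co (coB adm c0 ec unc comp); exact: (levB (hF j) (bco _ _) (bco _ _)).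
have h2 : `|psum e s k| <= d / 4 + d / 4.
  rewrite (_ : psum e s k = psum e (tail (wl n) J) k + psum e (tail (wlev F (co x)) J) k).
    apply: le_trans (ler_normD _ _) _; apply: lerD.
      apply: le_trans (hJ1 n k nK); apply: psum_mono => // j; rewrite /tail.
      by case: ifP => // Jj; rewrite ?normr0 ?(leq_trans (leq_maxl _ _) Jj).
    apply: le_trans (hJ2 k); apply: psum_mono => // j; rewrite /tail.
    by case: ifP => // Jj; rewrite ?normr0 ?(leq_trans (leq_maxr _ _) Jj).
  by rewrite /psum -big_split; apply: eq_bigr => j _; rewrite scalerDl.
have h3 : `|psum e b k| <= J%:R * `|C| * r.
  apply: (@le_trans _ _ (\sum_(0 <= j < k) if (j < J)%N then `|C| * r else 0)).
    rewrite /psum; apply: le_trans (ler_norm_sum _ _ _) _; apply: ler_sum => j _.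
    rewrite /b; case: ifP => jJ; last by rewrite scale0r normr0.
    rewrite normrZ (ger0_norm (w0 _ _)) mulrC ler_pM ?w0//.
      by have /andP[_ eC] := ec j; apply: le_trans eC _; exact: ler_norm.
    rewrite /a /wlev; apply: le_trans (nlev j jJ).
    apply: ler_piMl; first exact: (lev_ge0 (hF j) (bco _ _)).
    by rewrite invf_le1 ?exprn_gt0// exprn_ege1// ler1n.
  apply: (@le_trans _ _ ((minn k J)%:R * (`|C| * r))); last first.
    rewrite -mulrA; apply: ler_wpM2r; first exact: mulr_ge0 (normr_ge0 _) (ltW r0).
    by rewrite ler_nat geq_minr.
  elim: k {h1 h2} => [|k IHk]; first by rewrite big_geq// min0n mul0r.
  rewrite big_nat_recr//=; case: ltnP => [kJ|Jk].
    move: IHk; rewrite (minn_idPl (ltnW kJ)) (minn_idPl kJ) => IHk.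
    by rewrite -[in leRHS]natr1 mulrDl mul1r lerD2r.
  by move: IHk; rewrite (minn_idPr Jk) (minn_idPr (leqW Jk)) addr0.
have h4 : J%:R * `|C| * r <= d / 4.
  rewrite /r mulrCA ger_pMr// ler_pdivrMr// mul1r.
  by rewrite lerDl.
lra.
Unshelve. all: by end_near. Qed.

End Ultra.

Let N_eq0 x : N x = 0 -> x = 0.
Proof.
move=> x0; apply/eqP; rewrite -normr_le0 -x0 NE.
exact: (sqnorm_norm (T_ 0) eps_gt0 sq_cvg).
Qed.

Let N_ub : exists K, 0 < K /\ forall x, N x <= K * `|x|.
Proof.
have [_ _ _ [k [K [k0 kK]]]] := fast; exists (`|K| + 1); split=> [|x].
  by rewrite ltr_wpDl.
have /andP[_ h] := kK x; apply: le_trans h _; rewrite ler_wpM2r//.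
by rewrite (le_trans (ler_norm K))// lerDl.
Qed.

(** The defect of [N] dominates that of its summand [T_ 0], which is strictly
    convex. *)
Let N_strict x y : N x <= 1 -> N y <= 1 -> 2 <= N (x + y) -> x = y.
Proof.
move=> x1 y1 xy.
have N0 z : 0 <= N z by rewrite NE sqnorm_ge0.
have gap0 : pgap N x y <= 0.
  have sq z : N z <= 1 -> N z ^+ 2 <= 1 by move=> z1; rewrite expr_le1.
  have : 2 ^+ 2 <= N (x + y) ^+ 2 by rewrite ler_sqr ?nnegrE.
  by rewrite /pgap; have := sq _ x1; have := sq _ y1; lra.
have T0 : pgap (T_ 0) x y <= 0.
  rewrite -(ler_pM2l (eps_gt0 0)) mulr0; apply: le_trans gap0; rewrite NE.
  exact: (pgap_term (T_ge0 0) (TD 0) T_ge0 TD eps_gt0 sq_cvg).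
have F0 : F 0%N = [set A | A = set0 \/ exists p, A = [set p]] by case: adm.
have coE : co x = co y.
  apply/funext; apply: (tri_strict (hF 0) F0 (aco x 0) (aco y 0)).
  move: T0; rewrite /pgap /T_ [co (x + y)](coD adm c0 ec unc comp) => T0.
  lra.
apply/eqP; rewrite -subr_eq0 -normr_eq0 (norm_co adm c0 ec unc comp).
rewrite (coB adm c0 ec unc comp) -/co coE -(coB adm c0 ec unc comp).
by rewrite -(norm_co adm c0 ec unc comp) subrr normr0.
Qed.

Let NB x y : N (x - y) = N (y - x).
Proof. by rewrite -[RHS]mul1r -normrN1 -NZ scaleN1r opprB. Qed.

Let N_ultralimit U : UltraFilter U -> \oo `<=` U ->
  exists x, N x <= 1 /\ forall d, 0 < d -> \forall n \near U, N (u n - x) <= d.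
Proof.
move=> UU Uoo; have PU : ProperFilter U by exact: ultra_proper.
have [x xU] := norm_ultralimit UU Uoo; have [K [K0 NK]] := N_ub.
have xN d : 0 < d -> \forall n \near U, N (u n - x) <= d.
  move=> d0; apply: filterS (xU _ (divr_gt0 d0 K0)) => n h.
  by apply: le_trans (NK _) _; rewrite mulrC -ler_pdivlMr.
exists x; split=> //; apply/ler_addgt0Pr => d d0.
have [n h] := filter_ex (xN _ d0).
by have := ND (u n) (x - u n); rewrite addrC subrK NB; have := u1 n; lra.
Qed.

(** All ultrafilter limits agree, so the sequence converges: otherwise it would
    stay away from one of them along some ultrafilter. *)
Lemma star_limit : exists x : X, N (u n - x) @[n --> \oo] --> (0 : R).
Proof.
have [U [UU Uoo]] := ultraFilterLemma (@eventually_filter).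
have [x [x1 xU]] := N_ultralimit UU Uoo; exists x.
have uniq_lim V : UltraFilter V -> \oo `<=` V -> forall y, N y <= 1 ->
    (forall d, 0 < d -> \forall n \near V, N (u n - y) <= d) -> x = y.
  move=> VV Voo y y1 yV; apply: N_strict => //.
  apply/ler_addgt0Pr => d d0; have d3 : 0 < d / 3 by rewrite divr_gt0.
  have [K hK] := (cvg_pairP (fun m n => N (u m + u n)) 2).1 u2 _ d3.
  have PU : ProperFilter U by exact: ultra_proper.
  have PV : ProperFilter V by exact: ultra_proper.
  have KU : U [set n | (K <= n)%N] by apply: Uoo; exists K.
  have KV : V [set n | (K <= n)%N] by apply: Voo; exists K.
  have [m [mK mx]] := filter_ex (filterI KU (xU _ d3)).
  have [n [nK ny]] := filter_ex (filterI KV (yV _ d3)).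
  have := hK m n mK nK; rewrite ler_norml => /andP[_ h].
  have h1 := ND (x + y) (u m + u n - (x + y)); rewrite addrC subrK in h1.
  have h2 := ND (u m - x) (u n - y); rewrite addrACA -opprD in h2.
  lra.
apply/cvg_seqP => d d0; apply: contrapT => nK.
pose B := [set n | d < N (u n - x)].
have PW : ProperFilter (within B \oo).
  apply: Build_ProperFilter.
  move=> [K _ hK]; apply: nK; exists K => n Kn.
  have N0 z : 0 <= N z by rewrite NE sqnorm_ge0.
  rewrite sub0r normrN ger0_norm// leNgt; apply/negP => Bn; exact: (hK n Kn Bn).
have [V [VV VW]] := ultraFilterLemma PW.
have PV : ProperFilter V by exact: ultra_proper.
have Voo : \oo `<=` V by move=> A Aoo; apply: VW; apply: filterS Aoo => n An _.
have VB : V B by apply: VW; exists 0%N => // n _ Bn; exact: Bn.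
have [y [y1 yV]] := N_ultralimit VV Voo.
have xy := uniq_lim V VV Voo y y1 yV.
have [n [Bn nd]] := filter_ex (filterI VB (yV _ d0)).
by move: nd; rewrite -xy leNgt => /negP; apply.
Qed.

End Converse.

Lemma reflexive_star_rotund : two_rotund (fun y : Y => `|y|) ->
  reflexive_space X -> two_rotund N.
Proof. by move=> rotY reflX u u1 u2; exact: star_limit. Qed.

End Main.

Theorem theorem3p2 (R : realType) (S : choiceType)
    (F : nat -> set (set (Sbar S)))
    (Y : completeNormedModType R) (e : nat -> Y)
    (X : completeNormedModType R) (iota : {linear c00 R (Sbar S) -> X})
    (eps : nat -> R) :
  (exists s t : S, s <> t) ->
  admissible F ->
  reflexive_space Y ->
  unconditional_basis e ->
  seminormalized e ->
  one_unconditional e ->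
  two_rotund (fun y : Y => `|y|) ->
  is_completion iota (norm_c00 F e) ->
  eps_fast F iota eps ->
  reflexive_space X <-> two_rotund (norm_star F iota eps).
Proof.
move=> _ adm _ _ [c [C [c0 ec]]] unc rotY comp fast; split.
  exact: (reflexive_star_rotund adm c0 ec unc comp fast rotY).
exact: (star_rotund_reflexive adm c0 ec unc comp fast).
Qed.
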